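(* Let $F$ be a field of characteristic $2$ and let $n>1$ be an integer. Let $\pi$ and $\pi'$ be anisotropic $n$-fold Pfister forms over $F$. (a) If $\pi$ and $\pi'$ are not totally separably linked, then there exists a field extension $E/F$ such that $\pi_E$ and $\pi'_E$ are anisotropic and totally inseparably linked, but not totally separably linked. (b) If $\pi$ and $\pi'$ are not totally inseparably linked, then there exists a field extension $E/F$ such that $\pi_E$ and $\pi'_E$ are anisotropic and totally separably linked, but not totally inseparably linked.
   Context: For $a\in F$, $[1,a]$ denotes the quadratic form $(x,y)\mapsto x^2+xy+ay^2$ on $F^2$. An $n$-fold Pfister form over $F$ ($n\geq 1$) is a quadratic form isometric to $\langle\langle b_1,\ldots,b_{n-1},a]] := \langle 1,b_1\rangle_b\otimes\cdots\otimes\langle 1,b_{n-1}\rangle_b\otimes[1,a]$ with $a\in F$, $b_i\in F^\times$, i.e. the orthogonal sum of the forms $\left(\prod_{i\in I}b_i\right)[1,a]$ over all subsets $I\subseteq\{1,\ldots,n-1\}$. A quadratic form $(V,q)$ is isotropic if $q(x)=0$ for some $x\ne 0$, anisotropic otherwise; it is hyperbolic if it is isometric to an orthogonal sum of copies of the hyperbolic plane $\mathbb{H}=[0,0]$, $(x,y)\mapsto xy$. $\pi_K$ denotes the scalar extension of $\pi$ to a field extension $K/F$. For $n$-fold Pfister forms $\pi,\pi'$ over a field $F$: $\pi$ is totally separably (resp. inseparably) linked to $\pi'$ if for every separable (resp. inseparable) quadratic field extension $K/F$ such that $\pi_K$ is hyperbolic, $\pi'_K$ is also hyperbolic; $\pi$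 and $\pi'$ are totally separably (resp. inseparably) linked if each is totally separably (resp. inseparably) linked to the other. *)

(* Defs.v *)
From HB Require Import structures.
From mathcomp Require Import all_boot all_order all_algebra all_field.
From mathcomp Require Import ring.

Set Implicit Arguments.
Unset Strict Implicit.
Unset Printing Implicit Defensive.

Import GRing.Theory.
Local Open Scope ring_scope.

Definition polar (F : fieldType) (V : lmodType F) (q : V -> F) (u v : V) : F :=
  q (u + v) - q u - q v.

(* [polar q] is symmetric, so linearity on the left makes it bilinear. *)
Definition quadratic_map (F : fieldType) (V : lmodType F) (q : V -> F) : Prop :=
  (forall (a : F) (v : V), q (a *: v) = a ^+ 2 * q v) /\
  (forall (a : F) (u v w : V),
     polar q (a *: u + v) w = a * polar q u w + polar q v w).

Record qform (F : fieldType) (V : vectType F) := QForm {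
  qmap :> V -> F;
  qmapP : quadratic_map qmap
}.

Section QuadraticMapClosure.

Variables (F : fieldType) (V : lmodType F).

Lemma quadratic_map_add (q1 q2 : V -> F) :
  quadratic_map q1 -> quadratic_map q2 -> quadratic_map (fun v => q1 v + q2 v).
Proof.
move=> [h1 b1] [h2 b2]; split=> [a v|a u v w].
  by rewrite h1 h2 mulrDr.
have E x y : polar (fun v => q1 v + q2 v) x y = polar q1 x y + polar q2 x y.
  by rewrite /polar; ring.
by rewrite !E b1 b2; ring.
Qed.

Lemma quadratic_map_scale (c : F) (q : V -> F) :
  quadratic_map q -> quadratic_map (fun v => c * q v).
Proof.
move=> [h b]; split=> [a v|a u v w]; first by rewrite h mulrCA.
have E x y : polar (fun v => c * q v) x y = c * polar q x y.
  by rewrite /polar; ring.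
by rewrite !E b; ring.
Qed.

Lemma quadratic_map_sum (I : finType) (P : pred I) (q : I -> V -> F) :
  (forall i, quadratic_map (q i)) ->
  quadratic_map (fun v => \sum_(i | P i) q i v).
Proof.
move=> hq; split=> [a v|a u v w].
  by rewrite mulr_sumr; apply: eq_bigr => i _; case: (hq i) => ->.
have E x y : polar (fun v => \sum_(i | P i) q i v) x y =
             \sum_(i | P i) polar (q i) x y by rewrite /polar !sumrB.
rewrite !E mulr_sumr -big_split /=.
by apply: eq_bigr => i _; case: (hq i) => _ ->.
Qed.

Lemma quadratic_map_mul (l1 l2 : V -> F) :
  scalar l1 -> scalar l2 -> quadratic_map (fun v => l1 v * l2 v).
Proof.
move=> s1 s2.
have z1 : l1 0 = 0 by have := s1 (-1) 0 0; rewrite scaler0 addr0 mulN1r addNr.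
have z2 : l2 0 = 0 by have := s2 (-1) 0 0; rewrite scaler0 addr0 mulN1r addNr.
have d1 x y : l1 (x + y) = l1 x + l1 y by rewrite -[x]scale1r s1 mul1r scale1r.
have d2 x y : l2 (x + y) = l2 x + l2 y by rewrite -[x]scale1r s2 mul1r scale1r.
have m1 a x : l1 (a *: x) = a * l1 x by rewrite -[a *: x]addr0 s1 z1 addr0.
have m2 a x : l2 (a *: x) = a * l2 x by rewrite -[a *: x]addr0 s2 z2 addr0.
split=> [a v|a u v w]; first by rewrite m1 m2; ring.
by rewrite /polar !(d1, d2, m1, m2); ring.
Qed.

End QuadraticMapClosure.

Lemma quadratic_map_comp (F : fieldType) (U V : lmodType F)
    (f : U -> V) (q : V -> F) :
  linear f -> quadratic_map q -> quadratic_map (fun u => q (f u)).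
Proof.
move=> lf [h b].
have z : f 0 = 0 by have := lf (-1) 0 0; rewrite scaler0 addr0 scaleN1r addNr.
have m a x : f (a *: x) = a *: f x by rewrite -[a *: x]addr0 lf z addr0.
have d x y : f (x + y) = f x + f y by rewrite -[x]scale1r lf !scale1r.
split=> [a v|a u v w]; first by rewrite m h.
by have := b a (f u) (f v) (f w); rewrite /polar -lf -!d.
Qed.

(* The binary form [a, b] : (x, y) |-> a x^2 + x y + b y^2. *)
Definition binary_map (F : fieldType) (a b : F) (v : F^o * F^o) : F :=
  a * (v.1 * v.1) + v.1 * v.2 + b * (v.2 * v.2).

Lemma binary_mapP (F : fieldType) (a b : F) : quadratic_map (binary_map a b).
Proof.
have s1 : scalar (fun v : (F^o * F^o)%type => v.1 : F) by [].
have s2 : scalar (fun v : (F^o * F^o)%type => v.2 : F) by [].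
apply: quadratic_map_add; first apply: quadratic_map_add.
- by apply: quadratic_map_scale; apply: quadratic_map_mul.
- exact: quadratic_map_mul.
- by apply: quadratic_map_scale; apply: quadratic_map_mul.
Qed.

Definition binary_form (F : fieldType) (a b : F) : qform (F^o * F^o)%type :=
  QForm (binary_mapP a b).

Definition scale_form (F : fieldType) (V : vectType F) (c : F) (q : qform V) :
  qform V := QForm (quadratic_map_scale c (qmapP q)).

Definition orth_sum_map (F : fieldType) (I : finType) (V : vectType F)
    (q : I -> qform V) (x : {ffun I -> V}) : F := \sum_i q i (x i).

Lemma orth_sum_mapP (F : fieldType) (I : finType) (V : vectType F)
    (q : I -> qform V) : quadratic_map (orth_sum_map q).
Proof.
apply: quadratic_map_sum => i; apply: quadratic_map_comp (qmapP (q i)).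
by move=> a u v; rewrite !ffunE.
Qed.

Definition orth_sum (F : fieldType) (I : finType) (V : vectType F)
    (q : I -> qform V) : qform {ffun I -> V} := QForm (orth_sum_mapP q).

(* A model of the scalar extension on V (x)_F E, identified with E^(dim V)
   through the basis [vbasis {:V}] of V; see [scalar_extE] below.  Another basis
   of V would give an isometric form. *)
Definition scalar_ext_map (F E : fieldType) (iota : {rmorphism F -> E})
    (V : vectType F) (q : qform V) (y : 'rV[E]_(\dim {:V})) : E :=
  let e i := tnth (vbasis {:V}) i in
  \sum_(i < \dim {:V}) iota (q (e i)) * (y 0 i * y 0 i) +
  \sum_(i < \dim {:V}) \sum_(j < \dim {:V} | (i < j)%N) iota (polar q (e i) (e j)) * (y 0 i * y 0 j).

Lemma scalar_ext_mapP (F E : fieldType) (iota : {rmorphism F -> E})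
    (V : vectType F) (q : qform V) : quadratic_map (scalar_ext_map iota q).
Proof.
have s i : scalar (fun y : 'rV[E]_(\dim {:V}) => y 0 i).
  by move=> a u v; rewrite !mxE.
apply: quadratic_map_add; apply: quadratic_map_sum => i; last first.
  apply: quadratic_map_sum => j.
  by apply: quadratic_map_scale; apply: quadratic_map_mul.
by apply: quadratic_map_scale; apply: quadratic_map_mul.
Qed.

Definition scalar_ext (F E : fieldType) (iota : {rmorphism F -> E})
    (V : vectType F) (q : qform V) : qform 'rV[E]_(\dim {:V}) :=
  QForm (scalar_ext_mapP iota q).

Section ScalarExtExtends.

Variables (F E : fieldType) (iota : {rmorphism F -> E}).
Variables (V : vectType F) (q : qform V).

Lemma quadratic_map_expand n (e : 'I_n -> V) (c : 'I_n -> F) :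
  q (\sum_i c i *: e i) =
  \sum_i q (e i) * (c i * c i) +
  \sum_(i < n) \sum_(j < n | (i < j)%N) polar q (e i) (e j) * (c i * c j).
Proof.
have [hh hb] := qmapP q.
have q0 : q 0 = 0 by rewrite -(scale0r (0 : V)) hh expr0n mul0r.
have qD u v : q (u + v) = q u + q v + polar q u v by rewrite /polar; ring.
have pC u v : polar q u v = polar q v u by rewrite /polar (addrC u) addrAC.
have p0 w : polar q 0 w = 0 by rewrite /polar add0r q0; ring.
have pZ a u w : polar q (a *: u) w = a * polar q u w.
  by rewrite -[a *: u]addr0 hb p0 addr0.
have pD u v w : polar q (u + v) w = polar q u w + polar q v w.
  by rewrite -[u]scale1r hb mul1r scale1r.
have pS m (g : 'I_m -> V) w : polar q (\sum_i g i) w = \sum_i polar q (g i) w.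
  by apply: (big_morph (fun u => polar q u w)).
elim: n e c => [|n IHn] e c; first by rewrite !big_ord0 q0 addr0.
rewrite !big_ord_recl /= qD IHn hh pC pS.
rewrite (_ : \sum_(j < n.+1 | (0 < j)%N) _ =
   \sum_(i < n) polar q (c (lift ord0 i) *: e (lift ord0 i)) (c ord0 *: e ord0)).
  rewrite (_ : \sum_(i < n) \sum_(j < n.+1 | _) _ =
     \sum_(i < n) \sum_(j < n | (i < j)%N)
       polar q (e (lift ord0 i)) (e (lift ord0 j)) *
       (c (lift ord0 i) * c (lift ord0 j))); first by ring.
  apply: eq_bigr => i _; rewrite big_mkcond big_ord_recl /= add0r.
  by rewrite -big_mkcond.
rewrite big_mkcond big_ord_recl /= add0r; apply: eq_bigr => i _.
by rewrite pZ [in RHS]pC pZ; ring.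
Qed.

Lemma scalar_extE (v : V) :
  scalar_ext iota q (\row_i iota (coord (vbasis {:V}) i v)) = iota (q v).
Proof.
rewrite [in RHS](coord_vbasis (memvf v)).
under eq_bigr => i _ do rewrite -tnth_nth.
rewrite quadratic_map_expand rmorphD !rmorph_sum /= /scalar_ext_map.
congr (_ + _); apply: eq_bigr => i _; first by rewrite !mxE !rmorphM.
by rewrite rmorph_sum; apply: eq_bigr => j _; rewrite !mxE !rmorphM.
Qed.

End ScalarExtExtends.

Definition isometric (F : fieldType) (V W : vectType F)
    (q : qform V) (q' : qform W) : Prop :=
  exists f : {linear V -> W}, bijective f /\ forall v, q' (f v) = q v.

Definition isotropic (F : fieldType) (V : vectType F) (q : qform V) : Prop :=
  exists v : V, v != 0 /\ q v = 0.

Definition anisotropic (F : fieldType) (V : vectType F) (q : qform V) : Prop :=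
  ~ isotropic q.

Definition hyperbolic_plane (F : fieldType) : qform (F^o * F^o)%type :=
  binary_form 0 0.

Definition hyperbolic (F : fieldType) (V : vectType F) (q : qform V) : Prop :=
  exists k : nat, isometric q (orth_sum (fun _ : 'I_k => hyperbolic_plane F)).

(* <<b_1, ..., b_m, a]], which is an (m + 1)-fold Pfister form. *)
Definition pfister_form (F : fieldType) (m : nat) (b : 'I_m -> F) (a : F) :
    qform {ffun {set 'I_m} -> (F^o * F^o)%type} :=
  orth_sum (fun I : {set 'I_m} =>
    scale_form (\prod_(i in I) b i) (binary_form 1 a)).

Definition is_pfister (n : nat) (F : fieldType) (V : vectType F) (q : qform V) :
    Prop :=
  (0 < n)%N /\
  exists (b : 'I_n.-1 -> F) (a : F),
    (forall i, b i != 0) /\ isometric q (pfister_form b a).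

Definition tot_sep_linked_to (F : fieldType) (V V' : vectType F)
    (p : qform V) (p' : qform V') : Prop :=
  forall K : fieldExtType F, \dim {:K} = 2%N -> separable 1%VS {:K} ->
    hyperbolic (scalar_ext (in_alg K) p) ->
    hyperbolic (scalar_ext (in_alg K) p').

Definition tot_insep_linked_to (F : fieldType) (V V' : vectType F)
    (p : qform V) (p' : qform V') : Prop :=
  forall K : fieldExtType F, \dim {:K} = 2%N -> ~~ separable 1%VS {:K} ->
    hyperbolic (scalar_ext (in_alg K) p) ->
    hyperbolic (scalar_ext (in_alg K) p').

Definition tot_sep_linked (F : fieldType) (V V' : vectType F)
    (p : qform V) (p' : qform V') : Prop :=
  tot_sep_linked_to p p' /\ tot_sep_linked_to p' p.

Definition tot_insep_linked (F : fieldType) (V V' : vectType F)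
    (p : qform V) (p' : qform V') : Prop :=
  tot_insep_linked_to p p' /\ tot_insep_linked_to p' p.

(* Main.v *)
Require Import Defs.
From HB Require Import structures.
From mathcomp Require Import all_boot all_order all_algebra all_field.
From mathcomp Require Import ring zify.
From mathcomp Require Import boolp.
From mathcomp Require filter.

Set Implicit Arguments.
Unset Strict Implicit.
Unset Printing Implicit Defensive.

Import GRing.Theory.
Local Open Scope ring_scope.

(* By roundness of Pfister forms, a quadratic extension [E(t)] with [t ^+ 2 = c t + g],
   [c = 1] (separable) or [c = 0] (inseparable), splits the Pfister form [P] as soon as
   [P(v) = g] and [b_P(v, e0) = c] for some [v], where [P(e0) = 1].  For each of the two
   kinds it is therefore enough to find an extension [E] over which this can be solved
   for all [g], for [P] as well as for [P'], while [P] stays anisotropic over [E] and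
   [P'] stays anisotropic over [K E], [K] being the given quadratic extension of [F] of
   the other kind.

   For a single [g], write [P = [1, a] _|_ W] and adjoin a generic vector [x] of [W] and
   then a root of [X ^+ 2 = c X + g + c a + W(x)].  If an anisotropic Pfister form [Q]
   became isotropic, then by roundness and by the Cassels-Pfister theorem, used one
   variable at a time, it would contain [T = [1, g + a] _|_ W] (when [c = 1]) or
   [T = <1, g> _|_ W] (when [c = 0]), which have the same dimension as [Q].  The second
   form is degenerate, so it cannot embed unless [g] is a square.  The first one has a
   nontrivial Arf invariant: over [F(sqrt b0)], where [b0] is a slot of [P], both [P] and
   [Q] would be hyperbolic, hence also [[1, g]], so that [X ^+ 2 = X + g] would have a root
   in [F(sqrt b0)] and then in [F].  As a quadratic extension of one kind does not split
   polynomials of the other kind, this argument also applies over [K E].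

   Ultraproducts then treat all [g] in [E] at once, and the union of a chain of such
   extensions treats its own elements. *)

(** * Quadratic forms of matrices and the Cassels-Pfister theorem *)

Section MatrixForms.

Variables (R : comNzRingType) (N : nat) (Q : 'M[R]_N).
Implicit Types (u v w : 'rV[R]_N).

(** [Q] need not be symmetric: in characteristic 2 the cross terms of a quadratic form do not come
    from a symmetric matrix. The polar form has matrix [Q + Q^T]. *)
Definition qfm v : R := (v *m Q *m v^T) 0 0.
Definition bfm v w : R := (v *m (Q + Q^T) *m w^T) 0 0.

Lemma mx11_tr (A : 'M[R]_1) : A^T 0 0 = A 0 0.
Proof. by rewrite mxE. Qed.

Lemma bfmDl u v w : bfm (u + v) w = bfm u w + bfm v w.
Proof. by rewrite /bfm !mulmxDl mxE. Qed.

Lemma bfmC v w : bfm v w = bfm w v.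
Proof.
by rewrite /bfm -mx11_tr !trmx_mul trmxK raddfD /= trmxK addrC mulmxA.
Qed.

Lemma bfmDr u v w : bfm u (v + w) = bfm u v + bfm u w.
Proof. by rewrite !(bfmC u) bfmDl. Qed.

Lemma bfmZl a v w : bfm (a *: v) w = a * bfm v w.
Proof. by rewrite /bfm -!scalemxAl mxE. Qed.

Lemma bfmZr a v w : bfm v (a *: w) = a * bfm v w.
Proof. by rewrite !(bfmC v) bfmZl. Qed.

Lemma bfm0l w : bfm 0 w = 0. Proof. by rewrite /bfm !mul0mx mxE. Qed.
Lemma bfm0r w : bfm w 0 = 0. Proof. by rewrite bfmC bfm0l. Qed.

Lemma bfmNl v w : bfm (- v) w = - bfm v w.
Proof. by rewrite -scaleN1r bfmZl mulN1r. Qed.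

Lemma bfmNr v w : bfm v (- w) = - bfm v w.
Proof. by rewrite !(bfmC v) bfmNl. Qed.

Lemma qfmZ a v : qfm (a *: v) = a ^+ 2 * qfm v.
Proof. by rewrite /qfm linearZ /= -!scalemxAl -scalemxAr !mxE expr2 mulrA. Qed.

Lemma qfm0 : qfm 0 = 0. Proof. by rewrite /qfm !mul0mx mxE. Qed.

Lemma qfmN v : qfm (- v) = qfm v.
Proof. by rewrite -scaleN1r qfmZ sqrrN expr1n mul1r. Qed.

Lemma qfmD v w : qfm (v + w) = qfm v + qfm w + bfm v w.
Proof.
have -> : bfm v w = (v *m Q *m w^T) 0 0 + (w *m Q *m v^T) 0 0.
  rewrite /bfm mulmxDr mulmxDl mxE; congr (_ + _).
  by rewrite -mx11_tr !trmx_mul !trmxK mulmxA.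
by rewrite /qfm linearD /= !mulmxDl !mulmxDr !mxE; ring.
Qed.

Lemma bfmvv v : bfm v v = qfm v *+ 2.
Proof. by rewrite /bfm mulmxDr mulmxDl mxE -[X in _ + X]mx11_tr !trmx_mul !trmxK mulmxA. Qed.

Lemma bfm_suml (I : Type) (s : seq I) (P : pred I) (x : I -> 'rV[R]_N) w :
  bfm (\sum_(i <- s | P i) x i) w = \sum_(i <- s | P i) bfm (x i) w.
Proof.
by apply: (big_morph (fun u => bfm u w)) => [u v|]; rewrite (bfmDl, bfm0l).
Qed.

Lemma qfm_mul M (A : 'M[R]_(M, N)) x :
  (x *m (A *m Q *m A^T) *m x^T) 0 0 = qfm (x *m A).
Proof. by rewrite /qfm trmx_mul !mulmxA. Qed.

End MatrixForms.

Section MapForms.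

Variables (R S : comNzRingType) (f : {rmorphism R -> S}) (N : nat) (Q : 'M[R]_N).

Lemma qfm_map v : qfm (map_mx f Q) (map_mx f v) = f (qfm Q v).
Proof. by rewrite /qfm map_trmx -!map_mxM mxE. Qed.

Lemma bfm_map v w : bfm (map_mx f Q) (map_mx f v) (map_mx f w) = f (bfm Q v w).
Proof. by rewrite /bfm !map_trmx -map_mxD -!map_mxM mxE. Qed.

End MapForms.

Definition aniso_mx (R : comNzRingType) N (Q : 'M[R]_N) :=
  forall v, qfm Q v = 0 -> v = 0.

Section CasselsPfister.

Variables (E : fieldType) (N : nat) (Q : 'M[E]_N).
Hypothesis anisoQ : aniso_mx Q.

Local Notation Qp := (map_mx polyC Q).
Implicit Types (r u : 'rV[{poly E}]_N) (c : 'rV[E]_N).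

Definition coefv k r : 'rV[E]_N := map_mx (coefp k) r.
Definition deg_le k r := forall j, (size (r 0%R j) <= k.+1)%N.

Lemma qfm_sum (R : comNzRingType) (P : 'M[R]_N) v :
  qfm P v = \sum_j \sum_i v 0 i * P i j * v 0 j.
Proof.
rewrite /qfm mxE; apply: eq_bigr => j _; by rewrite !mxE mulr_suml.
Qed.

Lemma coefM_top k (p q : {poly E}) : (size p <= k.+1)%N -> (size q <= k.+1)%N ->
  (p * q)`_(k + k) = p`_k * q`_k.
Proof.
move=> sp sq; rewrite coefM.
have ltk : (k < (k + k).+1)%N by rewrite ltnS leq_addr.
rewrite (bigD1 (Ordinal ltk)) //= addnK big1 ?addr0 // => i /eqP ne_ik.
have [lt_ik|lt_ki|eq_ik] := ltngtP i k.
- by rewrite [q`__]nth_default ?mulr0 // (leq_trans sq) // ltn_subRL ltn_add2r.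
- by rewrite [p`__]nth_default ?mul0r // (leq_trans sp).
- by case: ne_ik; apply: val_inj.
Qed.

(** Only the degree [k] parts of the entries contribute to the coefficient of degree [k + k]; for
    anisotropic [Q] it vanishes only if they all do. *)
Lemma qfm_deg k r : deg_le k r ->
  (size (qfm Qp r) <= (k + k).+1)%N /\ (qfm Qp r)`_(k + k) = qfm Q (coefv k r).
Proof.
move=> dr.
have eij i j : r 0 i * Qp i j * r 0 j = Q i j *: (r 0 i * r 0 j).
  by rewrite mxE -mul_polyC; ring.
have sij i j : (size (r 0%R i * Qp i j * r 0%R j)%R <= (k + k).+1)%N.
  rewrite eij; apply: leq_trans (size_scale_leq _ _) _.
  by apply: leq_trans (size_polyMleq _ _) _; have := dr i; have := dr j; lia.
split.
  rewrite qfm_sum; apply: leq_trans (size_sum _ _ _) _.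
  apply/bigmax_leqP => j _; apply: leq_trans (size_sum _ _ _) _.
  by apply/bigmax_leqP.
rewrite !qfm_sum coef_sum; apply: eq_bigr => j _; rewrite coef_sum.
by apply: eq_bigr => i _; rewrite eij coefZ coefM_top // !mxE /=; ring.
Qed.


Lemma deg_le_exists r : r != 0 -> exists k, deg_le k r /\ coefv k r != 0.
Proof.
move=> r0; pose m := \max_j size (r 0%R j).
have lem j : (size (r 0%R j) <= m)%N by rewrite /m; apply: leq_bigmax.
have m0 : (0 < m)%N.
  rewrite lt0n; apply: contraNneq r0 => m0; apply/eqP/rowP => j.
  by have := lem j; rewrite m0 leqn0 size_poly_eq0 mxE => /eqP.
exists m.-1; split=> [j|]; first by rewrite prednK.
have [j0 _] := rV0Pn _ r0; have card_gt0 : (0 < #|'I_N|)%N by apply/card_gt0P; exists j0.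
have [j def_m] := eq_bigmax (fun j => size (r 0%R j)) card_gt0.
apply/eqP => /rowP/(_ j); rewrite !mxE /= /m def_m -lead_coefE => /eqP.
by rewrite lead_coef_eq0 -size_poly_eq0 -def_m -/m; lia.
Qed.

Lemma aniso_poly : aniso_mx Qp.
Proof.
move=> r q0; apply/eqP/negPn/negP => /deg_le_exists [k [dr /negP[]]].
by apply/eqP/anisoQ; have [_ <-] := qfm_deg dr; rewrite q0 coef0.
Qed.

(** By anisotropy the leading coefficients cannot cancel, so the value has exactly twice the degree
    of the vector. *)
Lemma deg_le_qfm k u : (size (qfm Qp u) <= (k + k).+1)%N -> deg_le k u.
Proof.
have [->|u0 sq] := eqVneq u 0; first by move=> _ j; rewrite mxE size_poly0.
have [m [du cm]] := deg_le_exists u0.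
have [_ top] := qfm_deg du.
have le_mk : (m <= k)%N.
  rewrite leqNgt; apply/negP => lt_km; case/negP: cm; apply/eqP/anisoQ.
  by rewrite -top nth_default //; apply: leq_trans sq _; lia.
by move=> j; apply: leq_trans (du j) _.
Qed.

Lemma qfm_deg_lt d r : (0 < d)%N -> (forall j, (size (r 0%R j) < d)%N) ->
  (size (qfm Qp r) < (d + d).-1)%N.
Proof.
move=> d0 sr; have [d1|d1] := leqP d 1.
  have -> : r = 0.
    apply/rowP => j; have := sr j; rewrite mxE => sj; apply/eqP.
    by rewrite -size_poly_eq0; lia.
  by rewrite qfm0 size_poly0; lia.
have dr : deg_le d.-2 r by move=> j; have := sr j; lia.
by have [] := qfm_deg dr; lia.
Qed.

Lemma bfm_deg_lt d r c : (0 < d)%N -> (forall j, (size (r 0%R j) < d)%N) ->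
  (size (bfm Qp r (map_mx polyC c)) < d)%N.
Proof.
move=> d0 sr; rewrite /bfm mxE; apply: leq_ltn_trans (size_sum _ _ _) _.
rewrite -(ltn_predK d0) ltnS; apply/bigmax_leqP => j _.
rewrite !mxE mulrC mul_polyC; apply: leq_trans (size_scale_leq _ _) _.
apply: leq_trans (size_sum _ _ _) _; apply/bigmax_leqP => i _.
rewrite !mxE -rmorphD /= mulrC mul_polyC; apply: leq_trans (size_scale_leq _ _) _.
by rewrite -ltnS (ltn_predK d0) sr.
Qed.

(* Cassels' descent on the degree of the denominator [d]: the line through [r / d]
   and its polynomial part meets the quadric [Q = f] in a second point with a smaller
   denominator; a constant linear form with polynomial value at [r / d] takes the
   same value along this line. *)
Lemma cassels_pfister d r f : d != 0 -> qfm Qp r = d ^+ 2 * f ->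
  exists u, qfm Qp u = f /\
    forall c g, bfm Qp r (map_mx polyC c) = d * g -> bfm Qp u (map_mx polyC c) = g.
Proof.
have [n] := ubnP (size d); elim: n d r => // n IHn d r lt_dn d0 qr.
pose p := map_mx (fun x => x %/ d) r; pose r' := map_mx (fun x => x %% d) r.
have def_r : r = d *: p + r' by apply/rowP => j; rewrite !mxE [LHS](divp_eq _ d) mulrC.
have sr' j : (size (r' 0%R j) < size d)%N by rewrite mxE ltn_modp.
have dpos : (0 < size d)%N by rewrite size_poly_gt0.
(* A polynomial value at [r / d] makes the value at the remainder [r'] a multiple of [d]; its degree
   is below that of [d], so it is 0. *)
have lin c g : bfm Qp r (map_mx polyC c) = d * g ->
    bfm Qp r' (map_mx polyC c) = 0 /\ bfm Qp p (map_mx polyC c) = g.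
  rewrite {1}def_r bfmDl bfmZl => e.
  have e' : bfm Qp r' (map_mx polyC c) = d * (g - bfm Qp p (map_mx polyC c)).
    by rewrite mulrBr -e addrAC subrr add0r.
  have [g0|g0] := eqVneq (g - bfm Qp p (map_mx polyC c)) 0.
    by split; [rewrite e' g0 mulr0|apply/esym/eqP; rewrite -subr_eq0 g0].
  have lt := bfm_deg_lt c dpos sr'; suff: false by [].
  move: g0 dpos lt; rewrite e' -size_poly_gt0 => g0 dpos; rewrite size_mul -?size_poly_gt0 //.
  by move: g0 dpos; set x := size d; set y := size (g - _); lia.
have [r0|r0] := eqVneq r' 0.
  exists p; split=> [|c g /lin[]//].
  apply: (mulfI (expf_neq0 2 d0)); rewrite -qr def_r r0 addr0 qfmZ //.
have q0 : qfm Qp r' != 0 by apply: contra_neq r0 => /aniso_poly.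
(* On the line [p + x r'] the equation [Q = f] has the root [x = 1/d]; the other one is [x = h/d'].
   Since [Q(r') = d d'], the degree of [d'] is smaller than that of [d]. *)
pose h := qfm Qp p - f; pose d' := - (h * d) - bfm Qp p r'.
have qr' : qfm Qp r' = d * d'.
  have := qr; rewrite def_r qfmD qfmZ bfmZl => e.
  have -> : qfm Qp r' = d ^+ 2 * f - d ^+ 2 * qfm Qp p - d * bfm Qp p r' by rewrite -e; ring.
  by rewrite /d' /h; ring.
have d'0 : d' != 0 by apply: contra_neq q0 => e; rewrite qr' e mulr0.
have lt_d' : (size d' < n)%N.
  have := qfm_deg_lt dpos sr'; rewrite qr' size_mul //.
  by move: d'0; rewrite -size_poly_gt0; move: lt_dn dpos; move: (size d) (size d') => x y; lia.
have [] := IHn d' (d' *: p + h *: r') lt_d' d'0.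
  rewrite qfmD !qfmZ bfmZl bfmZr qr'.
  have -> : bfm Qp p r' = - (h * d) - d' by rewrite /d'; ring.
  have def_f : f = qfm Qp p - h by rewrite /h; ring.
  by rewrite [in RHS]def_f; ring.
move=> u [qu lu]; exists u; split=> // c g /lin [e1 e2].
by apply: lu; rewrite bfmDl !bfmZl e1 e2 mulr0 addr0.
Qed.

End CasselsPfister.

(** * Descent along rational function fields *)

Lemma fraction_numden (R : idomainType) (x : {fraction R}) :
  (frac (repr x)).2 != 0 /\ tofrac (frac (repr x)).2 * x = tofrac (frac (repr x)).1.
Proof.
split; first exact: denom_ratioP.
rewrite -[X in _ * X]reprK; unlock tofrac; rewrite -[LHS]FracField.pi_mul; apply/eqmodP => /=.
rewrite FracField.equivfE /FracField.mulf !numden_Ratio ?oner_neq0 ?mulf_neq0 ?denom_ratioP //.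
  by rewrite !mul1r mulr1 mulrC.
all: exact: oner_neq0.
Qed.

Section RationalFunctions.

Variable E : fieldType.

Definition ratf : fieldType := {fraction {poly E}}.
Definition ratC : {rmorphism E -> ratf} := @tofrac {poly E} \o polyC.
Definition ratX : ratf := tofrac 'X.

Lemma ratf_denom N (v : 'rV[ratf]_N) : exists (d : {poly E}) r,
  d != 0 /\ tofrac d *: v = map_mx (@tofrac {poly E}) r.
Proof.
pose n j := (frac (repr (v 0 j))).1; pose d j := (frac (repr (v 0 j))).2.
have dP j : d j != 0 /\ tofrac (d j) * v 0 j = tofrac (n j) by apply: fraction_numden.
exists (\prod_j d j), (\row_j (n j * \prod_(i | i != j) d i)); split.
  by apply/prodf_neq0 => j _; case: (dP j).
apply/rowP => j; rewrite !mxE (bigD1 j) //= !rmorphM /= mulrAC.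
by case: (dP j) => _ ->.
Qed.

Variables (N : nat) (Q : 'M[E]_N).
Hypothesis anisoQ : aniso_mx Q.

Local Notation QK := (map_mx ratC Q).
Local Notation Qp := (map_mx polyC Q).

Lemma qfm_tofrac u : qfm QK (map_mx (@tofrac {poly E}) u) = tofrac (qfm Qp u).
Proof. by rewrite map_mx_comp qfm_map. Qed.

Lemma bfm_tofrac u v : bfm QK (map_mx (@tofrac {poly E}) u) (map_mx (@tofrac {poly E}) v)
  = tofrac (bfm Qp u v).
Proof. by rewrite map_mx_comp bfm_map. Qed.

Lemma map_ratC m (v : 'rV[E]_m) :
  map_mx ratC v = map_mx (@tofrac {poly E}) (map_mx polyC v).
Proof. by apply/rowP => j; rewrite !mxE. Qed.

Lemma tofrac_inj : injective (@tofrac {poly E}).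
Proof. by move=> x y /eqP; rewrite tofrac_eq => /eqP. Qed.

Lemma aniso_ratf : aniso_mx QK.
Proof.
move=> v qv; have [d [r [d0 dv]]] := ratf_denom v.
have r0 : r = 0.
  apply: (aniso_poly anisoQ); apply: tofrac_inj.
  by rewrite -qfm_tofrac -dv qfmZ qv mulr0 tofrac0.
apply/eqP; have := congr1 (fun u => u == 0) dv.
by rewrite r0 map_mx0 eqxx scaler_eq0 tofrac_eq0 (negPf d0).
Qed.

Lemma cassels_pfister_ratf v f : qfm QK v = tofrac f ->
  exists u, qfm Qp u = f /\ forall c g, bfm QK v (map_mx ratC c) = tofrac g ->
    bfm Qp u (map_mx polyC c) = g.
Proof.
move=> qv; have [d [r [d0 dv]]] := ratf_denom v.
have [] := @cassels_pfister _ _ _ anisoQ d r f d0.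
  apply: tofrac_inj.
  by rewrite -qfm_tofrac -dv qfmZ qv rmorphM rmorphXn.
move=> u [qu lu]; exists u; split=> // c g bv; apply: lu; apply: tofrac_inj.
by rewrite -bfm_tofrac -dv bfmZl -map_mx_comp bv rmorphM.
Qed.

End RationalFunctions.

(** The map is the reflection along [x - y], whose value under [Q] is nonzero by anisotropy as soon
    as [x] and [y] differ. *)
Lemma aniso_reflection (K : fieldType) N (Q : 'M[K]_N) x y :
  aniso_mx Q -> qfm Q x = qfm Q y ->
  exists t : 'rV_N -> 'rV_N, [/\ forall u, qfm Q (t u) = qfm Q u,
    forall u v, bfm Q (t u) (t v) = bfm Q u v, t x = y &
    forall u, bfm Q u x = bfm Q u y -> t u = u].
Proof.
move=> anisoQ qxy; have [->|ne_xy] := eqVneq x y; first by exists id.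
have [w def_w] : exists w, w = x - y by exists (x - y).
have qw : qfm Q w != 0.
  by move: ne_xy; rewrite -subr_eq0 -def_w; apply: contra_neq => /anisoQ.
have bxw : bfm Q x w = qfm Q w.
  by rewrite def_w qfmD qfmN bfmDr bfmvv !bfmNr -qxy; ring.
exists (fun u => u - (bfm Q u w / qfm Q w) *: w); split.
- move=> u; rewrite qfmD qfmN qfmZ bfmNr bfmZr; field.
  exact: qw.
- move=> u v; rewrite !(bfmDl, bfmDr, bfmNl, bfmNr, bfmZl, bfmZr) bfmvv (bfmC Q w); field.
  exact: qw.
- by rewrite bxw divff // scale1r def_w opprB addrC subrK.
- by move=> u e; rewrite def_w bfmDr bfmNr e subrr mul0r scale0r subr0.
Qed.

(** Values of the quadratic form are recorded along with the pairings, because in characteristic 2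
    they cannot be recovered from these. Sequences over [nat] make shifting and merging painless. *)
Definition gram_eq (R : comNzRingType) r N (Q : 'M[R]_N) (w : nat -> 'rV_N)
    M (T : 'M[R]_M) (z : nat -> 'rV_M) :=
  forall i, (i < r)%N -> qfm Q (w i) = qfm T (z i) /\
    forall j, (j < r)%N -> bfm Q (w i) (w j) = bfm T (z i) (z j).

(* [t] being the variable, z_0 + t z_1, z_2, z_3, ... *)
Definition merge (E : fieldType) M (z : nat -> 'rV[E]_M) i : 'rV[ratf E]_M :=
  if i is i'.+1 then map_mx (ratC E) (z i'.+2)
  else map_mx (ratC E) (z 0%N) + ratX E *: map_mx (ratC E) (z 1%N).

Lemma qfm_linear_poly (E : fieldType) N (Q : 'M[E]_N) a b :
  qfm (map_mx polyC Q) (map_mx polyC a + 'X *: map_mx polyC b) =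
  (qfm Q a)%:P + 'X * (bfm Q a b)%:P + 'X^2 * (qfm Q b)%:P.
Proof. by rewrite qfmD qfmZ bfmZr !qfm_map bfm_map; ring. Qed.

Lemma quadratic_polyC_inj (E : fieldType) (a b c a' b' c' : E) :
  a%:P + 'X * b%:P + 'X^2 * c%:P = a'%:P + 'X * b'%:P + 'X^2 * c'%:P ->
  [/\ a = a', b = b' & c = c'].
Proof.
move/polyP => e; have := (e 0%N, e 1%N, e 2%N).
by rewrite !coefD !coefXM !coefXnM !coefC /= !addr0 !add0r => -[[-> ->] ->].
Qed.

Lemma mergeS (E : fieldType) M (z : nat -> 'rV[E]_M) i :
  merge z i.+1 = map_mx (ratC E) (z i.+2).
Proof. by []. Qed.

Section Descent.

Variables (E : fieldType) (N M : nat) (Q : 'M[E]_N) (T : 'M[E]_M) (z : nat -> 'rV[E]_M).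
Hypothesis anisoQ : aniso_mx Q.
Local Notation iota := (ratC E).
Local Notation QK := (map_mx iota Q).
Local Notation TK := (map_mx iota T).

(* The vectors are moved to constant ones one at a time: Cassels-Pfister provides the
   target, and the reflection over [E(t)] reaching it fixes the previous vectors. *)
Lemma gram_constant r w : gram_eq r.+1 QK w TK (merge z) ->
  forall k, (k <= r)%N -> exists w' c, gram_eq r.+1 QK w' TK (merge z) /\
    forall i, (i < k)%N -> w' i.+1 = map_mx iota (c i).
Proof.
move=> gw; elim=> [|k IHk] lt_kr; first by exists w, (fun=> 0).
have [w' [c [gw' cw']]] := IHk (ltnW lt_kr).
have [qk bk] := gw' k.+1 lt_kr.
have [] := @cassels_pfister_ratf _ _ _ anisoQ (w' k.+1) (qfm T (z k.+2))%:P.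
  by rewrite qk qfm_map.
move=> u [qu lu].
(* A constant value forces a constant vector. *)
have du : deg_le 0 u by apply: (deg_le_qfm anisoQ); rewrite qu size_polyC leq_b1.
pose a : 'rV_N := coefv 0 u.
have ua : u = map_mx polyC a.
  by apply/rowP => j; rewrite !mxE /=; apply: size1_polyC; apply: du.
have qa : qfm QK (w' k.+1) = qfm QK (map_mx iota a).
  by rewrite qk /= !qfm_map; congr (iota _); apply: (@polyC_inj E); rewrite -[RHS]qfm_map -ua qu.
have [t [tq tb tk tfix]] := aniso_reflection (aniso_ratf anisoQ) qa.
exists (t \o w'), (fun i => if (i < k)%N then c i else a); split.
  by move=> i /gw' [qi bi]; split=> [|j /bi] /=; rewrite (tq, tb).
move=> i; rewrite ltnS leq_eqVlt => /orP[/eqP->|lt_ik] /=; first by rewrite ltnn.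
(* The linear part of Cassels-Pfister gives [a] the same pairings as [w' k.+1] with the vectors
   already made constant, so the reflection fixes these. *)
rewrite lt_ik -cw' //; apply: tfix.
have lt_ir : (i.+1 < r.+1)%N by lia.
rewrite bfmC (bk _ lt_ir) !mergeS (cw' _ lt_ik) (bfm_map iota T) (bfm_map iota Q); congr (iota _).
apply: (@polyC_inj E); rewrite -[RHS]bfm_map [RHS]bfmC -ua; apply/esym/lu.
by rewrite -(cw' _ lt_ik) (bk _ lt_ir) !mergeS (bfm_map iota T).
Qed.

(* Since [Q] is anisotropic, the polynomial representative of [w 0] has degree at most 1;
   its two coefficients replace [w 0]. *)
Lemma merge_descent r w : gram_eq r.+1 QK w TK (merge z) ->
  exists w', gram_eq r.+2 Q w' T z.
Proof.
move=> /gram_constant/(_ _ (leqnn r)) [{}w [c [gw cw]]].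
have [q0 b0] := gw 0%N isT.
pose f := map_mx polyC (z 0%N) + 'X *: map_mx polyC (z 1%N).
have mf : merge z 0%N = map_mx (@tofrac {poly E}) f.
  by apply/rowP => j; rewrite !mxE /= rmorphD rmorphM.
have [] := @cassels_pfister_ratf _ _ _ anisoQ (w 0%N) (qfm (map_mx polyC T) f).
  by rewrite q0 mf qfm_tofrac.
move=> u [qu lu].
have df : deg_le 1 f.
  move=> j; rewrite !mxE (leq_trans (size_polyD _ _)) // geq_max mulrC mul_polyC.
  by rewrite !(leq_trans (size_scale_leq _ _)) ?size_polyX // (leq_trans (size_polyC_leq1 _)).
have du : deg_le 1 u by apply: (deg_le_qfm anisoQ); rewrite qu; case: (qfm_deg T df).
pose a := coefv 0 u; pose b := coefv 1 u.
have def_u : u = map_mx polyC a + 'X *: map_mx polyC b.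
  apply/rowP => j; rewrite !mxE /=; apply/polyP => -[|[|i]];
    rewrite coefD coefXM !coefC //= ?add0r ?addr0 //.
  by rewrite nth_default // (leq_trans (du j)).
have [qa bab qb] : [/\ qfm Q a = qfm T (z 0%N), bfm Q a b = bfm T (z 0%N) (z 1%N) &
    qfm Q b = qfm T (z 1%N)].
  by move: qu; rewrite def_u !qfm_linear_poly => /quadratic_polyC_inj.
have bc i : (i < r)%N -> bfm Q a (c i) = bfm T (z 0%N) (z i.+2) /\
    bfm Q b (c i) = bfm T (z 1%N) (z i.+2).
  move=> lt_ir; have [_ b0'] := gw 0%N isT.
  have /lu : bfm QK (w 0%N) (map_mx iota (c i)) =
      tofrac (bfm (map_mx polyC T) f (map_mx polyC (z i.+2))).
    by rewrite -(cw _ lt_ir) (b0' i.+1 lt_ir) mf mergeS -bfm_tofrac map_ratC.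
  rewrite def_u /f !bfmDl !bfmZl !bfm_map => e.
  have := @quadratic_polyC_inj E (bfm Q a (c i)) (bfm Q b (c i)) 0
    (bfm T (z 0%N) (z i.+2)) (bfm T (z 1%N) (z i.+2)) 0.
  by rewrite !mulr0 !addr0 => /(_ e)[].
exists (fun i => if i is i'.+1 then if i' is i''.+1 then c i'' else b else a).
have cc i : (i < r)%N -> qfm Q (c i) = qfm T (z i.+2) /\
    forall j, (j < r)%N -> bfm Q (c i) (c j) = bfm T (z i.+2) (z j.+2).
  move=> lt_ir; have [qi bi] := gw i.+1 lt_ir; split=> [|j lt_jr].
    by apply: (fmorph_inj iota); rewrite -qfm_map -cw // qi /= qfm_map.
  by apply: (fmorph_inj iota); rewrite -(bfm_map iota Q) -(cw _ lt_ir) -(cw _ lt_jr) (bi j.+1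
    lt_jr) !mergeS (bfm_map iota T).
move=> [|[|i]] lti; (split=> [|[|[|j]] ltj]); rewrite ?bfmvv ?qa ?qb //; try by case: (bc j ltj).
- by rewrite bfmC bab bfmC.
- by case: (cc i lti).
- by rewrite bfmC [RHS]bfmC; case: (bc i lti).
- by rewrite bfmC [RHS]bfmC; case: (bc i lti).
- by case: (cc i lti) => _; apply.
Qed.

End Descent.

Lemma fraction_lift (R : idomainType) (K : fieldType) (g : {rmorphism R -> K}) :
  injective g -> exists h : {rmorphism {fraction R} -> K}, forall x, h (tofrac x) = g x.
Proof.
move=> g_inj; pose h (x : {fraction R}) := g (frac (repr x)).1 / g (frac (repr x)).2.
have g0 d : d != 0 -> g d != 0 by rewrite -(rmorph0 g) (inj_eq g_inj).
have fracP (x : {fraction R}) : exists n d, d != 0 /\ tofrac d * x = tofrac n.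
  by eexists _, _; apply: fraction_numden.
(* [h] is computed from a chosen representative; any other numerator and denominator give the same
   value. *)
have hP x n d : d != 0 -> tofrac d * x = tofrac n -> h x = g n / g d.
  move=> d0 dx; have [e0 ex] := fraction_numden x; rewrite /h.
  set e := (_ (repr x)).2 in e0 ex *; set p := (_ (repr x)).1 in ex *.
  suff eq : p * d = n * e by apply/eqP; rewrite eqr_div ?g0 // -!rmorphM eq.
  by apply/eqP; rewrite -tofrac_eq !rmorphM /= -dx -ex; apply/eqP; ring.
have hz : zmod_morphism h.
  move=> x y; have [n [d [d0 dx]]] := fracP x; have [n' [d' [d0' dy]]] := fracP y.
  rewrite (hP x n d) // (hP y n' d') // (hP (x - y) (n * d' - n' * d) (d * d')) ?mulf_neq0 //.
    by rewrite rmorphB !rmorphM /=; field; rewrite !g0.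
  by rewrite !(rmorphM, rmorphB) /= -dx -dy; ring.
have hm : monoid_morphism h.
  split=> [|x y]; first by rewrite (hP 1 1 1) ?oner_neq0 ?mulr1 // rmorph1 divr1.
  have [n [d [d0 dx]]] := fracP x; have [n' [d' [d0' dy]]] := fracP y.
  rewrite (hP x n d) // (hP y n' d') // (hP (x * y) (n * n') (d * d')) ?mulf_neq0 //.
    by rewrite !rmorphM /=; field; rewrite !g0.
  by rewrite !rmorphM /= -dx -dy; ring.
pose m1 := GRing.isZmodMorphism.Build _ _ h hz.
pose m2 := GRing.isMonoidMorphism.Build _ _ h hm.
pose H : {rmorphism {fraction R} -> K} := HB.pack h m1 m2.
by exists H => x; rewrite /= (hP _ x 1) ?oner_neq0 ?tofrac1 ?mul1r // rmorph1 divr1.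
Qed.


Lemma ratf_map (E L : fieldType) (j : {rmorphism E -> L}) :
  exists h : {rmorphism ratf E -> ratf L},
    (forall x, h (ratC E x) = ratC L (j x)) /\ h (ratX E) = ratX L.
Proof.
pose g : {rmorphism {poly E} -> ratf L} := @tofrac {poly L} \o map_poly j.
have g_inj : injective g.
  by move=> p q /tofrac_inj/(map_inj_poly (fmorph_inj j) (rmorph0 _)).
have [h hP] := fraction_lift g_inj.
by exists h; split=> [x|]; rewrite [LHS]hP /= ?map_polyC ?map_polyX.
Qed.

Lemma eq_gram (R : comNzRingType) r N (Q : 'M[R]_N) w M (T T' : 'M[R]_M) z z' :
  T = T' -> z =1 z' -> gram_eq r Q w T z -> gram_eq r Q w T' z'.
Proof. by move=> <- ez gr i /gr[qi bi]; split=> [|j /bi]; rewrite -!ez. Qed.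

(* [E1] is E(x_1, ..., x_m), [z' 0] is z_0 + x_1 z_1 + ... + x_m z_m and [L1] is
   L(x_1, ..., x_m). *)
Lemma generic_values m (E : fieldType) M (T : 'M[E]_M) (z : nat -> 'rV[E]_M) :
  exists (E1 : fieldType) (i1 : {rmorphism E -> E1}) (z' : nat -> 'rV[E1]_M),
  [/\ forall k, z' k.+1 = map_mx i1 (z (m + k).+1),
      forall j, (forall i, (0 < i <= m)%N -> z i 0 j = 0) -> z' 0%N 0 j = i1 (z 0%N 0 j) &
      forall (L : fieldType) (j : {rmorphism E -> L}),
      exists (L1 : fieldType) (l : {rmorphism L -> L1}) (j1 : {rmorphism E1 -> L1}),
        (forall x, j1 (i1 x) = l (j x)) /\
        forall N (Q : 'M[L]_N), aniso_mx Q -> aniso_mx (map_mx l Q) /\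
          forall r w, gram_eq r.+1 (map_mx l Q) w (map_mx j1 (map_mx i1 T))
                        (map_mx j1 \o z') ->
          exists w', gram_eq (m + r).+1 Q w' (map_mx j T) (map_mx j \o z)].
Proof.
elim: m E T z => [|m IHm] E T z.
  exists E, idfun, z; split=> [k|//|L j]; first by rewrite map_mx_id.
  exists L, idfun, j; split=> // N Q aQ; rewrite !map_mx_id //; split=> // r w gw.
  by exists w.
(* The first variable merges [z 0] and [z 1]; the induction hypothesis over E(x_1) brings in the
   other variables. *)
have [E1 [i1 [z' [zS z0 zL]]]] := IHm (ratf E) (map_mx (ratC E) T) (merge z).
exists E1, (i1 \o ratC E : {rmorphism E -> E1}), z'; split=> [k|j zj|L j].
- by apply/rowP => c; rewrite zS !mxE.
- rewrite z0 /= => [|[|i] //= le_im].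
    by rewrite !mxE (zj 1%N) // rmorph0 mulr0 addr0.
  by rewrite !mxE (zj i.+2) // rmorph0.
have [h [hC hX]] := ratf_map j.
have [L1 [l [j1 [j1l descL]]]] := zL _ h.
exists L1, (l \o ratC L : {rmorphism L -> L1}), j1; split=> [x|N Q aQ].
  by rewrite /= j1l hC.
have -> : map_mx (l \o ratC L) Q = map_mx l (map_mx (ratC L) Q) by apply/matrixP => a b;
  rewrite !mxE.
have -> : map_mx j1 (map_mx (i1 \o ratC E) T) = map_mx j1 (map_mx i1 (map_mx (ratC E) T)).
  by apply/matrixP => a b; rewrite !mxE.
have [aQl dQ] := descL _ _ (aniso_ratf aQ); split=> // r w /dQ[w' gw'].
apply: (merge_descent aQ (w := w')); apply: eq_gram gw' => [|i].
  by apply/matrixP => a b; rewrite !mxE hC.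
case: i => [|i] /=; apply/rowP => k; rewrite !mxE ?hC //.
by rewrite rmorphD rmorphM /= hX !hC.
Qed.

(** * Quadratic extensions *)

Definition no_root (E : fieldType) (b d : E) := forall x : E, x ^+ 2 != b * x + d.

Section QuadraticField.

Variables (E : fieldType) (b d : E).

(* [(r, s)] stands for [r + s w] with [w ^+ 2 = b * w + d]. *)
Definition quad of no_root b d := (E * E)%type.
Hypothesis irr : no_root b d.
Local Notation K := (quad irr).

HB.instance Definition _ := GRing.Zmodule.copy K (E * E)%type.

Definition quad_one : K := (1, 0).
Definition quad_mul (x y : K) : K :=
  (x.1 * y.1 + d * (x.2 * y.2), x.1 * y.2 + x.2 * y.1 + b * (x.2 * y.2)).
(** The product of [r + s w] with its conjugate [r + b s - s w]; the inverse is the conjugate over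
    the norm. *)
Definition quad_norm (x : K) : E := x.1 ^+ 2 + b * x.1 * x.2 - d * x.2 ^+ 2.
Definition quad_inv (x : K) : K :=
  ((x.1 + b * x.2) / quad_norm x, - x.2 / quad_norm x).

Lemma quad_mulA : associative quad_mul.
Proof. by move=> x y z; congr pair => /=; ring. Qed.
Lemma quad_mulC : commutative quad_mul.
Proof. by move=> x y; congr pair => /=; ring. Qed.
Lemma quad_mul1 : left_id quad_one quad_mul.
Proof. by move=> [x y]; congr pair => /=; ring. Qed.
Lemma quad_mulD : left_distributive quad_mul +%R.
Proof. by move=> x y z; congr pair => /=; ring. Qed.
Lemma quad_one_neq0 : quad_one != 0.
Proof. by apply/eqP => -[/eqP]; rewrite oner_eq0. Qed.

HB.instance Definition _ := GRing.Zmodule_isComNzRing.Build K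
  quad_mulA quad_mulC quad_mul1 quad_mulD quad_one_neq0.

Lemma quad_norm_eq0 x : quad_norm x = 0 -> x = 0.
Proof.
case: x => r s; rewrite /quad_norm /= => n0.
have [s0|s0] := eqVneq s 0.
  move: n0; rewrite s0 mulr0 expr0n mulr0 subr0 addr0 => /eqP.
  by rewrite expf_eq0 /= => /eqP ->.
have /eqP[] := irr (- (r / s)).
apply/eqP; rewrite -subr_eq0; apply/eqP; rewrite -(mul0r (s ^- 2)) -n0; field; exact: s0.
Qed.

Lemma quad_mulV x : x != 0 -> quad_inv x * x = 1.
Proof.
move=> x0; have n0 : quad_norm x != 0 by apply: contra_neq x0; apply: quad_norm_eq0.
rewrite /quad_inv; congr pair => /=; last by field.
rewrite -(divff n0) [X in _ = X / _]/quad_norm.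
by move: n0; move: (quad_norm x) => n n0; field.
Qed.

Lemma quad_inv0 : quad_inv 0 = 0.
Proof. by congr pair => /=; rewrite !(mulr0, addr0, oppr0, mul0r). Qed.

HB.instance Definition _ := GRing.ComNzRing_isField.Build K quad_mulV quad_inv0.

Definition quadC (x : E) : K := (x, 0).
Lemma quadC_zmod : zmod_morphism quadC.
Proof. by move=> x y; congr pair => /=; rewrite subr0. Qed.
Lemma quadC_monoid : monoid_morphism quadC.
Proof. by split=> // x y; congr pair => /=; ring. Qed.
HB.instance Definition _ := GRing.isZmodMorphism.Build E K quadC quadC_zmod.
HB.instance Definition _ := GRing.isMonoidMorphism.Build E K quadC quadC_monoid.

Variables (L : fieldType) (j : {rmorphism E -> L}) (t : L).
Hypothesis root_t : t ^+ 2 = j b * t + j d.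

Definition quad_lift (x : K) : L := j x.1 + j x.2 * t.
Lemma quad_lift_zmod : zmod_morphism quad_lift.
Proof. by move=> x y; rewrite /quad_lift /= !rmorphB /=; ring. Qed.
Lemma quad_lift_monoid : monoid_morphism quad_lift.
Proof.
split=> [|x y]; first by rewrite /quad_lift /= rmorph1 rmorph0; ring.
rewrite /quad_lift /= !(rmorphD, rmorphM) /=.
have -> : (j x.1 + j x.2 * t) * (j y.1 + j y.2 * t) =
  j x.1 * j y.1 + (j x.1 * j y.2 + j x.2 * j y.1) * t + j x.2 * j y.2 * t ^+ 2 by ring.
by rewrite root_t; ring.
Qed.

Lemma quad_lift_exists : exists h : {rmorphism K -> L}, forall x, h (quadC x) = j x.
Proof.
pose m1 := GRing.isZmodMorphism.Build _ _ _ quad_lift_zmod.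
pose m2 := GRing.isMonoidMorphism.Build _ _ _ quad_lift_monoid.
pose h : {rmorphism K -> L} := HB.pack quad_lift m1 m2.
by exists h => x; rewrite /= /quad_lift /= rmorph0 mul0r addr0.
Qed.

End QuadraticField.

(** If the polynomial already has a root, [E'] is [E] itself. The third clause records which case
    occurs, and the last one lets both cases be mapped to larger fields in the same way. *)
Lemma adjoin_quadratic_root (E : fieldType) (b d : E) :
  exists (E' : fieldType) (i : {rmorphism E -> E'}) (w : E'),
  [/\ w ^+ 2 = i b * w + i d, forall x, exists r s, x = i r + i s * w,
    (forall x, exists r, x = i r) \/
      (no_root b d /\ forall r s, i r + i s * w = 0 -> r = 0 /\ s = 0) &
    forall (L : fieldType) (j : {rmorphism E -> L}) t, t ^+ 2 = j b * t + j d ->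
    exists j' : {rmorphism E' -> L}, forall x, j' (i x) = j x].
Proof.
have [irr|] := pselect (no_root b d); last first.
  move=> /existsNP[x /negP/negPn/eqP rx]; exists E, idfun, x; split=> //.
  - by move=> y; exists y, 0; rewrite mul0r addr0.
  - by left=> y; exists y.
  - by move=> L j _ _; exists j.
exists (quad irr), (@quadC E b d irr), ((0, 1) : quad irr); split.
- by rewrite expr2; congr pair => /=; ring.
- by move=> [r s]; exists r, s; congr pair => /=; ring.
- right; split=> // r s [] /=; rewrite !(mulr0, mulr1, mul0r, addr0, add0r) => -> ->.
  by [].
- by move=> L j t rt; apply: (quad_lift_exists irr rt).
Qed.

(** * Pfister forms *)

(* [pfister_dim k + 2 = 2 ^ (k + 1)], shaped so that the first two coordinates of the
   [k + 1]-st form are those of the [k]-th by computation. *)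
Fixpoint pfister_dim k := if k is k'.+1 then (pfister_dim k' + (pfister_dim k').+2)%N else 0%N.

Notation pN k := (pfister_dim k).+2.

Section PfisterMatrix.

Variable R : comNzRingType.

Definition pfister_base (a : R) : 'M[R]_2 :=
  delta_mx 0 0 + delta_mx 0 1 + a *: delta_mx 1 1.

Fixpoint pfister_mx k : ('I_k -> R) -> R -> 'M[R]_(pN k) :=
  match k with
  | 0 => fun _ a => pfister_base a
  | k'.+1 => fun b a => let P := pfister_mx (fun i => b (lift ord0 i)) a in
      block_mx P 0 0 (b ord0 *: P) : 'M_(pN k' + pN k')
  end.

Lemma qfm_addmx N (A B : 'M[R]_N) v : qfm (A + B) v = qfm A v + qfm B v.
Proof. by rewrite /qfm mulmxDr mulmxDl mxE. Qed.

Lemma qfm_scalemx N c (A : 'M[R]_N) v : qfm (c *: A) v = c * qfm A v.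
Proof. by rewrite /qfm -scalemxAr -scalemxAl mxE. Qed.

Lemma bfm_qfm N (A : 'M[R]_N) v w : bfm A v w = qfm A (v + w) - qfm A v - qfm A w.
Proof. by rewrite qfmD; ring. Qed.

Lemma bfm_scalemx N c (A : 'M[R]_N) v w : bfm (c *: A) v w = c * bfm A v w.
Proof. by rewrite !bfm_qfm !qfm_scalemx; ring. Qed.

Lemma qfm_delta N (i j : 'I_N) v : qfm (delta_mx i j : 'M[R]_N) v = v 0 i * v 0 j.
Proof.
by rewrite /qfm -(mul_delta_mx (R := R) (0 : 'I_1) i j) !mulmxA -colE -mulmxA -rowE mxE big_ord1
  !mxE.
Qed.

Lemma qfm_block N (A B : 'M[R]_N) x y :
  qfm (block_mx A 0 0 B) (row_mx x y) = qfm A x + qfm B y.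
Proof.
by rewrite /qfm mul_row_block !mulmx0 addr0 add0r tr_row_mx mul_row_col mxE.
Qed.

Lemma bfm_block N (A B : 'M[R]_N) x y x' y' :
  bfm (block_mx A 0 0 B) (row_mx x y) (row_mx x' y') = bfm A x x' + bfm B y y'.
Proof. by rewrite bfm_qfm add_row_mx !qfm_block !qfmD; ring. Qed.

Variables (k : nat) (b : 'I_k.+1 -> R) (a : R).
Local Notation P := (pfister_mx (fun i => b (lift ord0 i)) a).
Implicit Types x y : 'rV[R]_(pN k).

Lemma qfm_pfisterS x y :
  qfm (pfister_mx b a) (row_mx x y) = qfm P x + b ord0 * qfm P y.
Proof. by apply: etrans (qfm_block P (b ord0 *: P) x y) _; rewrite qfm_scalemx. Qed.

Lemma bfm_pfisterS x y x' y' : bfm (pfister_mx b a) (row_mx x y) (row_mx x' y') =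
  bfm P x x' + b ord0 * bfm P y y'.
Proof.
by apply: etrans (bfm_block P (b ord0 *: P) x y x' y') _; rewrite bfm_scalemx.
Qed.

End PfisterMatrix.

Lemma pfister_mx_map (R S : comNzRingType) (f : {rmorphism R -> S}) k (b : 'I_k -> R) a :
  map_mx f (pfister_mx b a) = pfister_mx (f \o b) (f a).
Proof.
elim: k b => [|k IHk] b.
  by apply/matrixP => i j; rewrite !mxE !rmorphD rmorphM /= !rmorph_nat.
pose P := pfister_mx (fun i => b (lift ord0 i)) a.
have := map_block_mx f P 0 0 (b ord0 *: P).
by rewrite !map_mx0 map_mxZ IHk.
Qed.

Notation pfister_e0 := (delta_mx 0 ord0).
Notation pfister_f0 := (delta_mx 0 (lift ord0 ord0)).

Lemma pfister_rowE (R : comNzRingType) k (v : 'rV[R]_(pN k.+1)) :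
  exists x y : 'rV[R]_(pN k), v = row_mx x y.
Proof.
by exists (@lsubmx R 1 (pN k) (pN k) v), (@rsubmx R 1 (pN k) (pN k) v);
  apply/esym/(@hsubmxK R 1 (pN k) (pN k) v).
Qed.

Section PfisterChar2.

Variable E : fieldType.
Hypothesis ch2 : 2%N \in [pchar E].

Lemma pfister_e0S k : pfister_e0 = row_mx pfister_e0 0 :> 'rV[E]_(pN k + pN k).
Proof.
apply/rowP => j; rewrite !mxE; case: (splitP j) => i ji; rewrite !mxE -!val_eqE /= ji //.
Qed.

Lemma pfister_f0S k : pfister_f0 = row_mx pfister_f0 0 :> 'rV[E]_(pN k + pN k).
Proof.
apply/rowP => j; rewrite !mxE; case: (splitP j) => i ji; rewrite !mxE -!val_eqE /= ji //.
Qed.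

Lemma row_mx_coord0 k (x y : 'rV[E]_(pN k)) :
  (row_mx x y : 'rV_(pN k.+1)) 0 ord0 = x 0 ord0.
Proof. by rewrite -[RHS](row_mxEl x y); congr (row_mx x y _ _); apply: val_inj. Qed.

Lemma row_mx_coord1 k (x y : 'rV[E]_(pN k)) :
  (row_mx x y : 'rV_(pN k.+1)) 0 (lift ord0 ord0) = x 0 (lift ord0 ord0).
Proof. by rewrite -[RHS](row_mxEl x y); congr (row_mx x y _ _); apply: val_inj. Qed.

Lemma qfm_base (a : E) v : qfm (pfister_base a) v =
  v 0 0 ^+ 2 + v 0 0 * v 0 1 + a * v 0 1 ^+ 2.
Proof. by rewrite !qfm_addmx qfm_scalemx !qfm_delta; ring. Qed.

Lemma qfm_e0 k (b : 'I_k -> E) a : qfm (pfister_mx b a) pfister_e0 = 1.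
Proof.
elim: k b => [|k IHk] b; first by rewrite qfm_base !mxE /=; ring.
by rewrite [X in qfm _ X]pfister_e0S qfm_pfisterS IHk qfm0; ring.
Qed.

Lemma qfm_f0 k (b : 'I_k -> E) a : qfm (pfister_mx b a) pfister_f0 = a.
Proof.
elim: k b => [|k IHk] b; first by rewrite qfm_base !mxE /=; ring.
by rewrite [X in qfm _ X]pfister_f0S qfm_pfisterS IHk qfm0; ring.
Qed.

Lemma char2_dbl (x : E) : x + x = 0.
Proof. exact: addrr_pchar2. Qed.

Lemma bfm_e0 k (b : 'I_k -> E) a v :
  bfm (pfister_mx b a) v pfister_e0 = v 0 (lift ord0 ord0).
Proof.
elim: k b v => [|k IHk] b v.
  rewrite bfm_qfm !qfm_base !mxE /=.
  transitivity (v 0 1 + (v 0 0 + v 0 0)); first by ring.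
  by rewrite char2_dbl addr0; congr (v _ _); apply: val_inj.
have [x [y ->]] := pfister_rowE v.
by rewrite [X in bfm _ _ X]pfister_e0S bfm_pfisterS IHk bfm0r mulr0 addr0 row_mx_coord1.
Qed.

Lemma bfm_f0 k (b : 'I_k -> E) a v :
  bfm (pfister_mx b a) v pfister_f0 = v 0 ord0.
Proof.
elim: k b v => [|k IHk] b v.
  rewrite bfm_qfm !qfm_base !mxE /=.
  transitivity (v 0 0 + (a * v 0 1 + a * v 0 1)); first by ring.
  by rewrite char2_dbl addr0; congr (v _ _); apply: val_inj.
have [x [y ->]] := pfister_rowE v.
by rewrite [X in bfm _ _ X]pfister_f0S bfm_pfisterS IHk bfm0r mulr0 addr0 row_mx_coord0.
Qed.

Lemma pfister_nondeg k (b : 'I_k -> E) a v : (forall i, b i != 0) ->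
  (forall w, bfm (pfister_mx b a) v w = 0) -> v = 0.
Proof.
elim: k b v => [|k IHk] b v b0 bv.
  apply/rowP => -[[|[|//]] lt2]; rewrite mxE.
    by rewrite -(bv pfister_f0) bfm_f0; congr (v _ _); apply: val_inj.
  by rewrite -(bv pfister_e0) bfm_e0; congr (v _ _); apply: val_inj.
have [x [y e]] := pfister_rowE v; rewrite {}e in bv *.
have -> : x = 0.
  apply: (IHk (fun i => b (lift ord0 i))) => [i|w]; first exact: b0.
  by have := bv (row_mx w (0 : 'rV_(pN k))); rewrite bfm_pfisterS bfm0r mulr0 addr0.
have -> : y = 0; last by rewrite row_mx0.
apply: (IHk (fun i => b (lift ord0 i))) => [i|w]; first exact: b0.
have /eqP := bv (row_mx (0 : 'rV_(pN k)) w); rewrite bfm_pfisterS bfm0r add0r mulf_eq0.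
by rewrite (negPf (b0 _)) => /eqP.
Qed.

Lemma sim_bfm N M (Q : 'M[E]_N) (P : 'M[E]_M) (S : 'M_(M, N)) c :
  (forall x, qfm Q (x *m S) = c * qfm P x) ->
  forall x y, bfm Q (x *m S) (y *m S) = c * bfm P x y.
Proof. by move=> qS x y; rewrite !bfm_qfm -mulmxDl !qS; ring. Qed.

(** A vector killed by a similitude is orthogonal to everything, and the polar form is
    nondegenerate. *)
Lemma sim_unit k (b : 'I_k -> E) a S c : (forall i, b i != 0) -> c != 0 ->
  (forall x, qfm (pfister_mx b a) (x *m S) = c * qfm (pfister_mx b a) x) -> S \in unitmx.
Proof.
move=> b0 c0 qS; rewrite -row_free_unit; apply: inj_row_free => v vS.
apply: (pfister_nondeg (a := a) b0) => w; apply: (mulfI c0).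
by rewrite -(sim_bfm qS) vS bfm0l mulr0.
Qed.

Lemma sim_inv N (P S : 'M[E]_N) c : S \in unitmx -> c != 0 ->
  (forall x, qfm P (x *m S) = c * qfm P x) ->
  forall x, qfm P (x *m invmx S) = c^-1 * qfm P x.
Proof.
by move=> uS c0 qS x; rewrite -{2}[x](mulmxKV uS) qS mulKf.
Qed.

(* A similitude of [P] with factor [q w1 + b * q w2] is assembled from similitudes
   [S1], [S2] with factors [q w1] and [q w2] as the block matrix
   [S1, S2; - b S2, (q w1 / q w2) S2 S1^-1 S2]: the lower right block makes the two
   cross terms cancel. *)
Lemma pfister_round k (b : 'I_k -> E) a v : (forall i, b i != 0) ->
  qfm (pfister_mx b a) v != 0 ->
  exists S, forall x, qfm (pfister_mx b a) (x *m S) =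
                      qfm (pfister_mx b a) v * qfm (pfister_mx b a) x.
Proof.
elim: k b v => [|k IHk] b v b0 qv.
  (* The form [1, a] is the norm form of the algebra generated by [u] with [u ^+ 2 = u - a]; this is
     the matrix of multiplication by [v]. *)
  exists (\matrix_(i, j) if i == 0 then v 0 j else
     if j == 0 then - a * v 0 1 else v 0 0 + v 0 1) => x.
  have e0 : ord0 = 0 :> 'I_2 by apply: val_inj.
  have e1 : lift ord0 ord0 = 1 :> 'I_2 by apply: val_inj.
  by rewrite !qfm_base !mxE !big_ord_recl !big_ord0 !mxE e0 e1 /=; ring.
have [w1 [w2 e]] := pfister_rowE v; rewrite {}e in qv *.
set P := pfister_mx (fun i => b (lift ord0 i)) a.
have {IHk} IHk w : qfm P w != 0 -> exists S, [/\ S \in unitmx,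
   forall x, qfm P (x *m S) = qfm P w * qfm P x &
   forall x, qfm P (x *m invmx S) = (qfm P w)^-1 * qfm P x].
  move=> qw; have b0' i : b (lift ord0 i) != 0 by [].
  have [S qS] := IHk _ _ b0' qw; have uS := sim_unit b0' qw qS; exists S; split=> //.
  exact: sim_inv.
have blockE (A B C D : 'M[E]_(pN k)) x y :
    row_mx x y *m (block_mx A B C D : 'M_(pN k.+1)) = row_mx (x *m A + y *m C) (x *m B + y *m D).
  exact: mul_row_block.
rewrite qfm_pfisterS -/P in qv *.
set l1 := qfm P w1 in qv *; set l2 := qfm P w2 in qv *.
have [l20|l20] := eqVneq l2 0.
  move: qv; rewrite l20 mulr0 addr0 => /IHk[S [uS qS _]].
  exists (block_mx S 0 0 S) => x; have [y [z ->]] := pfister_rowE x.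
  by rewrite blockE !mulmx0 addr0 add0r !qfm_pfisterS !qS -/l1; ring.
have [S2 [uS2 qS2 qS2']] := IHk _ l20.
have [l10|l10] := eqVneq l1 0.
  exists (block_mx 0 S2 (- b ord0 *: S2) 0) => x; have [y [z ->]] := pfister_rowE x.
  rewrite blockE !mulmx0 addr0 add0r !qfm_pfisterS -scalemxAr qfmZ !qS2 -/l2 -/P l10; ring.
have [S1 [uS1 qS1 qS1']] := IHk _ l10.
exists (block_mx S1 S2 (- b ord0 *: S2) ((l1 / l2) *: (S2 *m invmx S1 *m S2))) => x.
have [y [z ->]] := pfister_rowE x.
rewrite blockE !qfm_pfisterS -/P !qfmD -!scalemxAr !mulmxA !qfmZ !bfmZr.
rewrite !qS2 qS1' !qS2 qS1 -/l1 -/l2 (sim_bfm qS2).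
have -> : bfm P y (z *m S2 *m invmx S1) = l1^-1 * bfm P (y *m S1) (z *m S2).
  by rewrite -{2}[z *m S2](mulmxKV uS1) (sim_bfm qS1) mulKf.
by rewrite -/l2; field; rewrite l10 l20.
Qed.

(** If the half form [P] is isotropic, two copies of its subspace do. Otherwise a zero [(w1, w2)]
    gives [P(w1) = - b P(w2)] with both values nonzero; roundness yields a similitude of factor
    [P(w2) / P(w1) = - 1/b], whose graph is totally isotropic. *)
Lemma pfister_isotropic k (b : 'I_k -> E) a : (forall i, b i != 0) ->
  ~ aniso_mx (pfister_mx b a) ->
  exists n (Z : 'M[E]_(n, pN k)), (forall x, qfm (pfister_mx b a) (x *m Z) = 0) /\
    (\rank Z).*2 = pN k.
Proof.
elim: k b => [|k IHk] b b0.
  move=> /existsNP[v /not_implyP[qv /eqP v0]]; exists 1%N, v; split=> [x|].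
    by rewrite [x]mx11_scalar mul_scalar_mx qfmZ qv mulr0.
  by rewrite rank_rV v0.
set P := pfister_mx (fun i => b (lift ord0 i)) a => nP.
have b0' i : b (lift ord0 i) != 0 by [].
have [aP|/(IHk _ b0')[n [Z [qZ rZ]]]] := pselect (aniso_mx P); last first.
  exists (n + n)%N, (block_mx Z 0 0 Z); split=> [x|].
    rewrite -[x]hsubmxK (_ : _ *m _ = row_mx (lsubmx x *m Z) (rsubmx x *m Z)).
      by rewrite qfm_pfisterS !qZ mulr0 addr0.
    by rewrite [LHS]mul_row_block !mulmx0 addr0 add0r.
  have -> : \rank (block_mx Z 0 0 Z : 'M_(_, pN k.+1)) = (\rank Z + \rank Z)%N.
    exact: (rank_diag_block_mx Z Z).
  by rewrite addnn rZ -addnn.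
move: nP => /existsNP[v]; have [w1 [w2 ->]] := pfister_rowE v.
rewrite qfm_pfisterS -/P => /not_implyP[q12 v0].
have w20 : qfm P w2 != 0.
  apply: contra_not_neq v0 => /aP e; rewrite e in q12 *.
  by move: q12; rewrite qfm0 mulr0 addr0 => /aP ->; rewrite row_mx0.
have w10 : qfm P w1 != 0.
  apply: contraNneq w20 => w10; move/eqP: q12; rewrite w10 add0r mulf_eq0.
  by rewrite (negPf (b0 _)).
have [S2 qS2] := pfister_round b0' w20; have [S1 qS1] := pfister_round b0' w10.
have qS1' := sim_inv (sim_unit b0' w10 qS1) w10 qS1.
exists (pN k), (row_mx 1%:M (invmx S1 *m S2)); split=> [x|].
  rewrite (_ : _ *m _ = row_mx x (x *m invmx S1 *m S2)); last first.
    by rewrite [LHS]mul_mx_row mulmx1 mulmxA.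
  rewrite qfm_pfisterS qS2 qS1' -/P.
  have -> : qfm P x + b ord0 * (qfm P w2 * ((qfm P w1)^-1 * qfm P x)) =
     (qfm P w1 + b ord0 * qfm P w2) / qfm P w1 * qfm P x by field.
  by rewrite q12 !mul0r.
have -> : \rank (row_mx 1%:M (invmx S1 *m S2) : 'M_(_, pN k + pN k)) = pN k.
  apply/eqP; apply: inj_row_free => x /eqP; rewrite mul_mx_row row_mx_eq0 mulmx1.
  by case/andP=> /eqP.
by rewrite -addnn.
Qed.

End PfisterChar2.

(** * Embeddings of twisted Pfister forms *)

(* The order 1, 2, ..., m + 1, 0 of the basis vectors makes the one completed to a
   generic vector come first and [e0] last. *)
Definition basis_rot (R : comNzRingType) m i : 'rV[R]_m.+2 := delta_mx 0 (inord (i.+1 %% m.+2)).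

Lemma gram_sum (R : comNzRingType) (I : eqType) N (Q : 'M[R]_N) M (T : 'M[R]_M) u t (x : I -> R)
  s :
  (forall i, qfm Q (u i) = qfm T (t i)) -> (forall i j, bfm Q (u i) (u j) = bfm T (t i) (t j)) ->
  qfm Q (\sum_(i <- s) x i *: u i) = qfm T (\sum_(i <- s) x i *: t i).
Proof.
move=> qut but; elim: s => [|i s IHs]; first by rewrite !big_nil !qfm0.
rewrite !big_cons !qfmD !qfmZ IHs qut !(bfmC _ (_ *: _)) !bfm_suml; congr (_ + _).
by apply: eq_bigr => j _; rewrite !bfmZl !bfmZr but.
Qed.

Lemma gram_isometry (R : comNzRingType) N (Q : 'M[R]_N) m (T : 'M[R]_m.+2) w :
  gram_eq m.+2 Q w T (@basis_rot R m) ->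
  exists W, forall x, qfm Q (x *m W) = qfm T x.
Proof.
(* The position of the [j]-th basis vector in the rotated order, that is [j - 1] modulo [m.+2]. *)
move=> gw; pose idx (j : 'I_m.+2) := ((j + m.+1) %% m.+2)%N.
have lt_idx j : (idx j < m.+2)%N by rewrite ltn_mod.
have idxK j : @basis_rot R m (idx j) = delta_mx 0 j.
  rewrite /basis_rot; congr delta_mx; apply: val_inj; rewrite /= inordK ?ltn_mod //.
  by rewrite -addn1 modnDml -addnA addn1 modnDr modn_small.
exists (\matrix_j w (idx j)) => x; rewrite [in RHS](row_sum_delta x) mulmx_sum_row.
apply: gram_sum => [i|i j]; rewrite !rowK -!idxK; first by case: (gw _ (lt_idx i)).
by case: (gw _ (lt_idx i)) => _; apply.
Qed.

(* If [b] is true, [T] is [1, g + a] _|_ W, otherwise it is <1, g> _|_ W, where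
   P = [1, a] _|_ W. *)
Definition twist_mx (R : comNzRingType) (b : bool) m (P : 'M[R]_m.+2) (a g : R) : 'M[R]_m.+2 :=
  let j := lift ord0 ord0 in
  P + (if b then g *: delta_mx j j else delta_mx ord0 j + (a + g) *: delta_mx j j).

Lemma twist_mx_map (R S : comNzRingType) (f : {rmorphism R -> S}) b m (P : 'M[R]_m.+2) a g :
  map_mx f (twist_mx b P a g) = twist_mx b (map_mx f P) (f a) (f g).
Proof.
by apply/matrixP => i j; rewrite !mxE rmorphD; case: b;
  rewrite /= !mxE ?rmorphD !rmorphM ?rmorphD !rmorph_nat.
Qed.

Lemma qfm_twist (R : comNzRingType) b m (P : 'M[R]_m.+2) a g v :
  let j := lift ord0 ord0 in qfm (twist_mx b P a g) v = qfm P v +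
  (if b then g * v 0 j ^+ 2 else v 0 ord0 * v 0 j + (a + g) * v 0 j ^+ 2).
Proof.
by rewrite /= qfm_addmx; case: b; rewrite ?qfm_addmx qfm_scalemx !qfm_delta expr2.
Qed.

Section TotallyIsotropic.

Variables (E : fieldType) (N : nat) (T : 'M[E]_N).

(* [K Z] is the part of [Z] orthogonal to [U]; it lies in [U] and is orthogonal to [Z],
   so both [K] and [U] are controlled by the rank of the pairing of [Z] and [U]. *)
Lemma totally_isotropic_rank p q (Z : 'M[E]_(p, N)) (U : 'M[E]_(q, N)) :
  (forall x, qfm T (x *m Z) = 0) ->
  (forall v, v *m (T + T^T) *m U^T = 0 -> qfm T v = 0 -> (v <= U)%MS) ->
  (\rank Z <= \rank U)%N.
Proof.
wlog [fZ fU] : p q Z U / row_free Z /\ row_free U => [IH|].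
  move=> qZ UP; rewrite -(eq_row_base Z) -(eq_row_base U).
  apply: IH; first by rewrite !row_base_free.
    by move=> x; have /submxP[y ->] : (x *m row_base Z <= Z)%MS by rewrite (submx_trans (submxMl
      _ _)) ?eq_row_base.
  move=> v vU qv; rewrite eq_row_base; apply: UP => //.
  have /submxP[D ->] : (U <= row_base U)%MS by rewrite eq_row_base.
  by rewrite trmx_mul mulmxA vU mul0mx.
move=> qZ UP; rewrite (eqP fZ) (eqP fU).
set B := T + T^T in UP *; have trB : B^T = B by rewrite /B linearD /= trmxK addrC.
have ZZ : Z *m B *m Z^T = 0.
  apply/matrixP => i j; rewrite [RHS]mxE; transitivity (bfm T (row i Z) (row j Z)).
    by rewrite /bfm -row_mul [LHS]mxE [RHS]mxE; apply: eq_bigr => l _; rewrite !mxE.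
  by rewrite bfm_qfm !rowE -mulmxDl !qZ !subr0.
pose C := Z *m B *m U^T; pose K := kermx C.
have KU : (K *m Z <= U)%MS.
  apply/row_subP => i; apply: UP; last by rewrite row_mul qZ.
  have e : K *m Z *m B *m U^T = K *m C by rewrite /C !mulmxA.
  by rewrite -!row_mul e mulmx_ker row0.
have [K' eK] := submxP KU.
have K'0 : (K' <= kermx (U *m B *m Z^T))%MS.
  by apply/sub_kermxP; rewrite !mulmxA -eK -(mulmxA K) -(mulmxA K) ZZ mulmx0.
have := mxrankS K'0; rewrite mxrank_ker.
have -> : \rank (U *m B *m Z^T) = \rank C by rewrite -mxrank_tr !trmx_mul trmxK trB mulmxA.
have : (\rank K <= \rank K')%N by rewrite -(mxrankMfree K fZ) eK mxrankM_maxl.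
rewrite mxrank_ker; have := rank_leq_row C; have := rank_leq_col C; lia.
Qed.

End TotallyIsotropic.

Section TwistEmbedding.

Variable L : fieldType.
Hypothesis ch2 : 2%N \in [pchar L].

Local Notation o1 := (lift ord0 ord0).

Lemma bfm_twist b m (P : 'M[L]_m.+2) a g v w :
  bfm (twist_mx b P a g) v w = bfm P v w +
  (if b then 0 else v 0 ord0 * w 0 o1 + w 0 ord0 * v 0 o1).
Proof.
rewrite !bfm_qfm !qfm_twist !mxE /=; case: b.
  transitivity (qfm P (v + w) - qfm P v - qfm P w + (g * v 0 o1 * w 0 o1 + g * v 0 o1 * w 0 o1)).
    by ring.
  by rewrite (char2_dbl ch2).
set c := a + g.
transitivity (qfm P (v + w) - qfm P v - qfm P w + (v 0 ord0 * w 0 o1 + w 0 ord0 * v 0 o1) +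
  (c * v 0 o1 * w 0 o1 + c * v 0 o1 * w 0 o1)); first by ring.
by rewrite (char2_dbl ch2) addr0.
Qed.

Variables (k : nat) (b b' : 'I_k -> L) (a a' g : L).
Hypotheses (b0 : forall i, b i != 0) (b'0 : forall i, b' i != 0).
Local Notation P := (pfister_mx b a).
Local Notation Q := (pfister_mx b' a').

(** The polar form of [T] has radical spanned by [e0] and [f0], on which [T] is <1, g>. Without a
    square root of [g] this is anisotropic, so [W] is injective, hence invertible. Then the image of
    [e0] is orthogonal to everything and must be 0, although [T(e0) = 1]. *)
Lemma twist_insep_embedding W : (forall x, qfm Q (x *m W) = qfm (twist_mx false P a g) x) ->
  ~ no_root 0 g.
Proof.
set T := twist_mx _ _ _ _ => qW nr.
have bW x y : bfm Q (x *m W) (y *m W) = bfm T x y.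
  by rewrite !bfm_qfm -mulmxDl !qW.
have uW : W \in unitmx.
  rewrite -row_free_unit; apply: inj_row_free => x xW.
  have bx y : bfm P x y = x 0 ord0 * y 0 o1 + y 0 ord0 * x 0 o1.
    have := bW x y; rewrite xW bfm0l bfm_twist => /esym/eqP.
    by rewrite addr_eq0 (oppr_pchar2 ch2) => /eqP.
  have def_x : x = x 0 ord0 *: pfister_e0 + x 0 o1 *: pfister_f0.
    apply/eqP; rewrite -subr_eq0; apply/eqP.
    apply: (pfister_nondeg ch2 (b := b) (a := a)) => // y.
    rewrite !(bfmDl, bfmNl, bfmZl) !(bfmC P (delta_mx _ _)) bfm_e0 // bfm_f0 // bx.
    by ring.
  have := qW x; rewrite xW qfm0 qfm_twist {1}def_x qfmD !qfmZ bfmZl bfmZr bfmC.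
  rewrite bfm_e0 // qfm_e0 // qfm_f0 // mxE !eqxx mulr1 /=.
  set r := x 0 ord0 in def_x *; set s := x 0 o1 in def_x * => /esym.
  rewrite [X in X = 0](_ : _ = r ^+ 2 + g * s ^+ 2 +
     ((r * s + r * s) + (s ^+ 2 * a + s ^+ 2 * a))); last by ring.
  rewrite !(char2_dbl ch2) !addr0 => rs.
  have [s0|s0] := eqVneq s 0.
    move: rs; rewrite s0 expr0n mulr0 addr0 => /eqP; rewrite expf_eq0 /= => /eqP r0.
    by rewrite def_x r0 s0 !scale0r addr0.
  case/eqP: (nr (r / s)); rewrite mul0r add0r.
  apply: (mulIf (expf_neq0 2 s0)); rewrite -exprMn divfK //.
  by apply/eqP; rewrite -[g * _](oppr_pchar2 ch2) -addr_eq0; apply/eqP.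
have e0 : pfister_e0 *m W = 0 :> 'rV_(pN k).
  apply: (pfister_nondeg ch2 (b := b') (a := a')) => // y.
  rewrite -(mulmxKV uW y) bW bfm_twist bfmC bfm_e0 // !mxE /=.
  by rewrite mulr0n mulr0 addr0 mul1r (char2_dbl ch2).
have := qW pfister_e0; rewrite e0 qfm0 qfm_twist qfm_e0 // !mxE /= => /esym/eqP.
by rewrite !(mulr0n, mulr0, expr0n, addr0) /= oner_eq0.
Qed.

(** The separable twist has the same polar form as [P], which is nondegenerate. *)
Lemma twist_sep_unit W : (forall x, qfm Q (x *m W) = qfm (twist_mx true P a g) x) ->
  W \in unitmx.
Proof.
move=> qW; rewrite -row_free_unit; apply: inj_row_free => x xW.
apply: (pfister_nondeg ch2 (b := b) (a := a)) => // y.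
have <- : bfm (twist_mx true P a g) x y = bfm P x y by rewrite bfm_twist addr0.
by rewrite bfm_qfm -!qW mulmxDl xW add0r qfm0 subr0 subrr.
Qed.

End TwistEmbedding.

(* When [t ^+ 2 = b ord0], the vectors [(x, x / t)] with [x] orthogonal to [e0] form a
   totally isotropic subspace of dimension one less than half, and the form induced on
   its orthogonal is [1, g]. *)
Lemma twist_sep_totally_isotropic (L : fieldType) (ch2 : 2%N \in [pchar L])
    k (b : 'I_k.+1 -> L) a g t n (Z : 'M_(n, pN k.+1)) :
  (forall i, b i != 0) -> t ^+ 2 = b ord0 -> no_root 1 g ->
  (forall x, qfm (twist_mx true (pfister_mx b a) a g) (x *m Z) = 0) ->
  ((\rank Z).*2 < pN k.+1)%N.
Proof.
move=> b0 t2 nr qZ; set T := twist_mx _ _ _ _ in qZ.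
have t0 : t != 0 by apply: contra_neq (b0 ord0) => t0; rewrite -t2 t0 expr0n.
set P := pfister_mx (fun i : 'I_k => b (lift ord0 i)) a.
(* [D] erases coordinate 1, which is the pairing with [e0]; so it projects onto the orthogonal of
   [e0]. *)
pose D : 'M[L]_(pN k) := 1%:M - delta_mx (lift ord0 ord0) (lift ord0 ord0).
pose U : 'M[L]_(pN k, pN k.+1) := row_mx D (t^-1 *: D).
have rU : (\rank U < pN k)%N.
  rewrite ltn_neqAle rank_leq_row andbT; apply/negP => fU.
  have fU' : (pfister_f0 : 'rV[L]_(pN k)) *m U = 0.
    have := mul_mx_row (pfister_f0 : 'rV[L]_(pN k)) D (t^-1 *: D).
    rewrite -scalemxAr /D mulmxBr mulmx1 mul_delta_mx subrr scaler0 row_mx0 => e; exact: e.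
  have := @row_free_inj _ 1 _ _ U fU pfister_f0 0;
    rewrite fU' mul0mx => /(_ erefl)/rowP/(_ (lift ord0 ord0)).
  by rewrite !mxE !eqxx => /eqP; rewrite oner_eq0.
suff : (\rank Z <= \rank U)%N by move: rU => /= ; lia.
apply: (totally_isotropic_rank qZ) => v vU qv.
have [x [y e]] := pfister_rowE v; rewrite {v}e in vU qv *.
have bU z : bfm P (x + t *: y) (z *m D) = 0.
  have : bfm T (row_mx x y) (z *m U) = 0.
    by rewrite /bfm trmx_mul mulmxA vU mul0mx mxE.
  have -> : z *m U = row_mx (z *m D) (t^-1 *: (z *m D)).
    by have := mul_mx_row z D (t^-1 *: D); rewrite -scalemxAr => e; exact: e.
  rewrite /T bfm_twist // addr0 bfm_pfisterS -/P bfmZr bfmDl bfmZl -t2.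
  by move: (bfm _ _ _) (bfm _ _ _) => c d <-; field.
pose l := bfm P (x + t *: y) pfister_f0.
(* This vector is orthogonal to the orthogonal of [e0], hence a multiple of [e0]. *)
have xy : x + t *: y = l *: pfister_e0.
  apply/eqP; rewrite -subr_eq0; apply/eqP.
  apply: (pfister_nondeg ch2 (b := fun i => b (lift ord0 i)) (a := a)) => // z.
  rewrite bfmDl bfmNl bfmZl (bfmC _ (delta_mx _ _)) bfm_e0 //.
  have zD : z *m D = z - z 0 (lift ord0 ord0) *: pfister_f0.
    suff zd : z *m (delta_mx (lift ord0 ord0) (lift ord0 ord0) : 'M_(pN k)) = z 0 (lift ord0
      ord0) *: pfister_f0.
      by rewrite /D mulmxBr mulmx1 zd.
    apply/rowP => j; rewrite !mxE (bigD1 (lift ord0 ord0)) //= big1 ?addr0 ?mxE // => i /negPf ni.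
    by rewrite mxE ni mulr0.
  have {1}-> : z = z *m D + z 0 (lift ord0 ord0) *: pfister_f0 by rewrite zD subrK.
  by rewrite bfmDr bU add0r bfmZr -/l; ring.
(* Since [b ord0 * P(y) = P(t y)], the value of [T] at [(x, y)] is that of [1, g] at [l] and
   coordinate 1 of [x]; both then vanish because [no_root 1 g]. *)
have q0 : l ^+ 2 + l * x 0 (lift ord0 ord0) + g * x 0 (lift ord0 ord0) ^+ 2 = 0.
  have ey : t *: y = l *: pfister_e0 - x by rewrite -xy addrAC subrr add0r.
  have := qv; rewrite /T qfm_twist qfm_pfisterS -/P -t2 -qfmZ ey row_mx_coord1.
  rewrite qfmD qfmN qfmZ qfm_e0 // bfmZl bfmNr bfmC bfm_e0 // => e.
  rewrite -e -[in LHS](oppr_pchar2 ch2 (l * _)).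
  set r := x 0 _; set q := qfm P x.
  transitivity (l ^+ 2 - l * r + g * r ^+ 2 + (q + q)); first by rewrite (char2_dbl ch2) addr0.
  by ring.
have x1 : x 0 (lift ord0 ord0) = 0.
  apply/eqP/negPn/negP => s0; case/eqP: (nr (l / x 0 (lift ord0 ord0))).
  move: q0 s0; set s := x 0 _ => q0 s0; rewrite mul1r.
  apply: (mulIf (expf_neq0 2 s0)); rewrite -exprMn divfK //.
  apply/eqP; rewrite -subr_eq0 (oppr_pchar2 ch2); apply/eqP; rewrite -q0; field; exact: s0.
have l0 : l = 0.
  by move/eqP: q0; rewrite x1 mulr0 expr0n mulr0 !addr0 expf_eq0 => /eqP.
apply/submxP; exists x.
have xD : x *m D = x.
  apply/rowP => j; rewrite /D mulmxBr mulmx1 !mxE (bigD1 (lift ord0 ord0)) //= big1 => [|i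
    /negPf ni].
    by rewrite x1 mul0r addr0 subr0.
  by rewrite mxE ni mulr0.
have := mul_mx_row x D (t^-1 *: D); rewrite -scalemxAr xD => e; apply/esym/(etrans e).
congr row_mx; move/eqP: xy; rewrite l0 scale0r addr_eq0 => /eqP ->.
by rewrite scalerN scalerA mulVf // scale1r -scaleN1r (oppr_pchar2 ch2) scale1r.
Qed.

Lemma gram_eq_map (R S : comNzRingType) (f : {rmorphism R -> S}) r N (Q : 'M[R]_N) w M (T :
  'M[R]_M) z :
  gram_eq r Q w T z ->
  gram_eq r (map_mx f Q) (map_mx f \o w) (map_mx f T) (map_mx f \o z).
Proof.
move=> gr i /gr[qi bi]; split=> [|j /bi bij]; rewrite /= ?qfm_map ?qi //.
by rewrite !(bfm_map f) bij.
Qed.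

Lemma basis_rot_map (R S : comNzRingType) (f : {rmorphism R -> S}) m i :
  map_mx f (@basis_rot R m i) = @basis_rot S m i.
Proof. by rewrite /basis_rot map_delta_mx. Qed.

(* [s] tells the separable kind X^2 = X + g from the inseparable kind X^2 = g; the
   extension [E'] of [E] is of the other kind. *)
Lemma no_root_quadratic_ext (E E' : fieldType) (i : {rmorphism E -> E'}) (w : E') (s : bool) d g :
  2%N \in [pchar E] -> w ^+ 2 = i (~~ s)%:R * w + i d ->
  (forall x, exists r t, x = i r + i t * w) ->
  (forall x, exists r, x = i r) \/ (forall r t, i r + i t * w = 0 -> r = 0 /\ t = 0) ->
  no_root s%:R g -> no_root s%:R (i g).
Proof.
move=> ch2 w2 span dich nr x; apply/eqP => rx.
have root0 r : x = i r -> False.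
  move=> xr; case/eqP: (nr r); apply: (fmorph_inj i).
  by rewrite rmorphXn rmorphD rmorphM rmorph_nat -xr.
have [sur|indep] := dich; first by have [r /root0] := sur x.
have [r [t xrt]] := span x.
(* These are the coordinates of [x ^+ 2 - s x - g] on 1 and [w], the cross term of the square being
   even. The second one is [- t] or [t ^+ 2] according to [s], so [t = 0] and the root lies in
   [E]. *)
have [|_ t0] := indep (r ^+ 2 + t ^+ 2 * d - s%:R * r - g) (t ^+ 2 * (~~ s)%:R - s%:R * t).
  rewrite !(rmorphB, rmorphD, rmorphM, rmorphXn) /= rmorph_nat.
  have ch2' : 2%N \in [pchar E'] by rewrite (fmorph_pchar i).
  have -> : i r ^+ 2 + i t ^+ 2 * i d - s%:R * i r - i g +
      (i t ^+ 2 * i (~~ s)%:R - s%:R * i t) * w =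
      x ^+ 2 - (s%:R * x + i g) - (i r * i t * w + i r * i t * w) +
      i t ^+ 2 * (i (~~ s)%:R * w + i d - w ^+ 2) by rewrite xrt; ring.
  by rewrite -w2 rx (char2_dbl ch2') !subrr mulr0 ?subr0 addr0.
apply: (root0 r); rewrite xrt; have -> : t = 0; last by rewrite rmorph0 mul0r addr0.
move/eqP: t0; case: (s) => /=; first by rewrite mulr0 add0r mul1r oppr_eq0 => /eqP.
by rewrite mulr1 mul0r subr0 expf_eq0 => /eqP.
Qed.

(** Over [M], obtained from [L] by adjoining a square root of a slot, [T] and hence [Q] become
    isotropic, so [Q] has a totally isotropic subspace of half dimension. Carried back to [T], it
    exceeds the bound above, since X^2 = X + g still has no root in [M]. *)
Lemma twist_sep_embedding (L : fieldType) (ch2 : 2%N \in [pchar L])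
    k (b b' : 'I_k.+1 -> L) a a' g w :
  (forall i, b i != 0) -> (forall i, b' i != 0) ->
  gram_eq (pN k.+1) (pfister_mx b' a') w (twist_mx true (pfister_mx b a) a g)
    (@basis_rot L _) -> ~ no_root 1 g.
Proof.
move=> b0 b'0 gw nr.
have [M [i [t [t2 span dich _]]]] := adjoin_quadratic_root 0 (b ord0).
have nrM : no_root 1 (i g).
  apply: (@no_root_quadratic_ext _ _ i t true _ _ ch2 t2 span _ nr).
  by case: dich => [|[]]; [left|right].
have ch2M : 2%N \in [pchar M] by rewrite (fmorph_pchar i).
have ib0 : forall j, (i \o b) j != 0 by move=> j; rewrite fmorph_eq0.
have ib'0 : forall j, (i \o b') j != 0 by move=> j; rewrite fmorph_eq0.
have t2' : t ^+ 2 = (i \o b) ord0 by rewrite t2 rmorph0 mul0r add0r.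
have [W qW] : exists W, forall x, qfm (pfister_mx (i \o b') (i a')) (x *m W) =
    qfm (twist_mx true (pfister_mx (i \o b) (i a)) (i a) (i g)) x.
  apply: (@gram_isometry _ _ _ _ _ (map_mx i \o w)).
  rewrite -!pfister_mx_map -twist_mx_map.
  by apply: eq_gram (gram_eq_map i gw) => // j; rewrite /= basis_rot_map.
have uW := twist_sep_unit ch2M ib0 qW.
have t0 : t != 0 by apply: contra_neq (ib0 ord0) => t0; rewrite -t2' t0 expr0n.
have nQ : ~ aniso_mx (pfister_mx (i \o b') (i a')).
  (* The value of [T] here is [t ^+ 2] plus the slot, twice the same element. *)
  pose v : 'rV_(pN k.+1) := row_mx (t *: pfister_e0 : 'rV_(pN k)) (pfister_e0 : 'rV_(pN k)).
  move=> /(_ (v *m W)); rewrite qW qfm_twist qfm_pfisterS qfmZ !qfm_e0 // t2' row_mx_coord1.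
  rewrite !mxE /= !mulr1 mulr0n mulr0 expr0n mulr0 addr0 (char2_dbl ch2M) => /(_ erefl) vW.
  have /rowP/(_ ord0) : v = 0 by rewrite -(mulmxK uW v) vW mul0mx.
  by rewrite row_mx_coord0 !mxE /= => /eqP; rewrite mulr1 (negPf t0).
have [n [Z [qZ rZ]]] := pfister_isotropic ch2M ib'0 nQ.
have qZ' x : qfm (twist_mx true (pfister_mx (i \o b) (i a)) (i a) (i g)) (x *m (Z *m invmx W)) =
  0.
  by rewrite -qW mulmxA mulmxKV.
have := twist_sep_totally_isotropic ch2M ib0 t2' nrM qZ'.
by rewrite mxrankMfree ?row_free_unit ?unitmx_inv // rZ ltnn.
Qed.

(** * Splitting one quadratic polynomial *)

(* [Q] stays anisotropic after adjoining [t] with [t ^+ 2 = c * t + g], expressed on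
   the coordinates of [v + t *: w]. *)
Definition aniso_quad (E : fieldType) N (Q : 'M[E]_N) (c g : E) :=
  forall v w, qfm Q v + g * qfm Q w = 0 -> bfm Q v w + c * qfm Q w = 0 -> v = 0 /\ w = 0.

Section QuadraticExtensionForms.

Variables (E E' : fieldType) (i : {rmorphism E -> E'}) (t : E') (c g : E).
Hypothesis root_t : t ^+ 2 = i c * t + i g.
Variables (N : nat) (Q : 'M[E]_N).

Lemma qfm_quad v w : qfm (map_mx i Q) (map_mx i v + t *: map_mx i w) =
  i (qfm Q v + g * qfm Q w) + i (bfm Q v w + c * qfm Q w) * t.
Proof.
rewrite qfmD qfmZ bfmZr !qfm_map bfm_map !(rmorphD, rmorphM) root_t /=; ring.
Qed.

Lemma aniso_quad_extend : (forall x, exists r s, x = i r + i s * t) ->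
  aniso_quad Q c g -> (forall r s, i r + i s * t = 0 -> r = 0 /\ s = 0) ->
  aniso_mx (map_mx i Q).
Proof.
move=> span aQ indep x qx.
have [r /fin_all_exists[s xrs]] := fin_all_exists (fun j => span (x 0 j)).
have def_x : x = map_mx i (\row_j r j) + t *: map_mx i (\row_j s j).
  by apply/rowP => j; rewrite !mxE xrs mulrC.
have [q0 b0] : qfm Q (\row_j r j) + g * qfm Q (\row_j s j) = 0 /\
    bfm Q (\row_j r j) (\row_j s j) + c * qfm Q (\row_j s j) = 0.
  by apply: indep; rewrite -qfm_quad -def_x.
by have [r0 s0] := aQ _ _ q0 b0; rewrite def_x r0 s0 !map_mx0 scaler0 addr0.
Qed.

(** [E'] may be larger than E(t); the absence of roots in [E] makes 1 and [t] independent. *)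
Lemma aniso_quad_restrict : no_root c g -> aniso_mx (map_mx i Q) -> aniso_quad Q c g.
Proof.
move=> nr aQ v w qv bv.
have vw : map_mx i v + t *: map_mx i w = 0.
  by apply: aQ; rewrite qfm_quad qv bv rmorph0 mul0r addr0.
have w0 : w = 0.
  apply/rowP => j; rewrite mxE; apply/eqP/negPn/negP => wj.
  have tj : t = i (- v 0 j / w 0 j).
    move/rowP: vw => /(_ j); rewrite !mxE => vwj.
    apply: (mulIf (_ : i (w 0 j) != 0)); first by rewrite fmorph_eq0.
    by rewrite -rmorphM divfK // rmorphN; apply/eqP; rewrite -addr_eq0 addrC vwj.
  case/eqP: (nr (- v 0 j / w 0 j)); apply: (fmorph_inj i).
  by rewrite rmorphXn rmorphD rmorphM -tj.
split=> //; apply/rowP => j; move/rowP: vw => /(_ j).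
by rewrite w0 !mxE rmorph0 mulr0 addr0 => /eqP; rewrite fmorph_eq0 => /eqP.
Qed.

End QuadraticExtensionForms.

Lemma aniso_map (E E' : fieldType) (i : {rmorphism E -> E'}) N (Q : 'M[E]_N) :
  aniso_mx (map_mx i Q) -> aniso_mx Q.
Proof.
move=> aQ v qv; have /rowP v0 : map_mx i v = 0 by apply: aQ; rewrite qfm_map qv rmorph0.
by apply/rowP => j; have /eqP := v0 j; rewrite !mxE fmorph_eq0 => /eqP.
Qed.

Lemma aniso_map_surj (E E' : fieldType) (i : {rmorphism E -> E'}) N (Q : 'M[E]_N) :
  (forall x, exists r, x = i r) -> aniso_mx Q -> aniso_mx (map_mx i Q).
Proof.
move=> sur aQ v; have [r vr] := fin_all_exists (fun j => sur (v 0 j)).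
have -> : v = map_mx i (\row_j r j) by apply/rowP => j; rewrite !mxE.
rewrite qfm_map => /eqP; rewrite fmorph_eq0 => /eqP/aQ ->.
by rewrite map_mx0.
Qed.

Lemma aniso_quad_aniso (E : fieldType) N (Q : 'M[E]_N) c g : aniso_quad Q c g -> aniso_mx Q.
Proof.
move=> aQ v qv; have [] // := aQ v 0; first by rewrite qfm0 mulr0 addr0.
by rewrite bfm0r qfm0 mulr0 addr0.
Qed.

(** Turns the absence of roots into anisotropy of a binary form, which is known to survive generic
    extensions. *)
Lemma no_root_aniso (E : fieldType) (c g : E) : 2%N \in [pchar E] ->
  no_root c g <-> aniso_mx (delta_mx 0 0 + c *: delta_mx 0 1 + g *: delta_mx 1 1 : 'M[E]_2).
Proof.
move=> ch2; have qE v : qfm (delta_mx 0 0 + c *: delta_mx 0 1 + g *: delta_mx 1 1 : 'M[E]_2) v =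
    v 0 0 ^+ 2 + c * (v 0 0 * v 0 1) + g * v 0 1 ^+ 2.
  by rewrite !qfm_addmx !qfm_scalemx !qfm_delta !expr2.
split=> [nr v|aQ x].
  rewrite qE => qv; have v1 : v 0 1 = 0.
    apply/eqP/negPn/negP => v1; case/eqP: (nr (v 0 0 / v 0 1)).
    move: qv v1; move: (v 0 0) (v 0 1) => r s rs s0.
    apply: (mulIf (expf_neq0 2 s0)); rewrite -exprMn divfK //.
    by apply/eqP; rewrite -subr_eq0 (oppr_pchar2 ch2); apply/eqP; rewrite -rs; field.
  move: qv; rewrite v1 mulr0 expr0n !mulr0 !addr0 => /eqP; rewrite expf_eq0 /= => /eqP v0.
  apply/rowP => -[[|[|//]] lt2]; rewrite mxE; first by rewrite -v0; congr (v _ _); apply: val_inj.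
  by rewrite -v1; congr (v _ _); apply: val_inj.
apply/eqP => rx; have /rowP/(_ 1) : (\row_(j < 2) if j == 0 then x else 1) = 0.
  apply: aQ; rewrite qE !mxE /= rx mulr1 expr1n mulr1.
  have -> : c * x + g + c * x + g = (c * x + g) + (c * x + g) by ring.
  exact: char2_dbl.
by rewrite !mxE /= => /eqP; rewrite oner_eq0.
Qed.

Lemma basis_rotE (R : comNzRingType) n i j :
  @basis_rot R n i 0 j = (i.+1 %% n.+2 == j)%N%:R.
Proof. by rewrite /basis_rot mxE eqxx -val_eqE /= inordK ?ltn_mod // eq_sym. Qed.

Section Step.

Variables (E : fieldType) (k : nat) (s : bool).
Hypotheses (ch2 : 2%N \in [pchar E]).
Variables (b : 'I_k.+1 -> E) (a g : E).
Hypothesis b0 : forall i, b i != 0.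

Local Notation m := (pfister_dim k.+1).
Local Notation T := (twist_mx s (pfister_mx b a) a g).

Lemma twist_embedding (L : fieldType) (j : {rmorphism E -> L}) (b' : 'I_k.+1 -> L) a' w :
  (forall i, b' i != 0) ->
  gram_eq m.+2 (pfister_mx b' a') w (map_mx j T) (map_mx j \o @basis_rot E m) ->
  ~ no_root s%:R (j g).
Proof.
move=> b'0 gw; have ch2L : 2%N \in [pchar L] by rewrite (fmorph_pchar j).
have jb0 : forall i, (j \o b) i != 0 by move=> i; rewrite fmorph_eq0.
have {}gw : gram_eq m.+2 (pfister_mx b' a') w
    (twist_mx s (pfister_mx (j \o b) (j a)) (j a) (j g)) (@basis_rot L m).
  by apply: eq_gram gw => [|i]; rewrite ?twist_mx_map ?pfister_mx_map //= basis_rot_map.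
case: s gw => gw; first exact: twist_sep_embedding gw.
by have [W qW] := gram_isometry gw; apply: twist_insep_embedding qW.
Qed.

(* [E'] is E(x)(w), where [w ^+ 2 = s * w + D] and D is the value of [T] at a generic
   vector with coordinates 0 and 1 equal to 0 and 1. *)
Lemma generic_representation :
  exists (E1 E' : fieldType) (i1 : {rmorphism E -> E1}) (i' : {rmorphism E1 -> E'}) (w : E') (D
    : E1),
  [/\ [/\ w ^+ 2 = i' s%:R * w + i' D, forall x, exists r t, x = i' r + i' t * w &
        (forall x, exists r, x = i' r) \/ (forall r t, i' r + i' t * w = 0 -> r = 0 /\ t = 0)],
      exists v, qfm (map_mx (i' \o i1) (pfister_mx b a)) v = i' (i1 g) /\
                bfm (map_mx (i' \o i1) (pfister_mx b a)) v pfister_e0 = s%:R,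
      forall c g', no_root c g' -> no_root (i1 c) (i1 g') &
      forall (L : fieldType) (j : {rmorphism E -> L}) (b' : 'I_k.+1 -> L) a',
        (forall i, b' i != 0) -> aniso_mx (pfister_mx b' a') -> no_root s%:R (j g) ->
        exists (L' : fieldType) (l : {rmorphism L -> L'}) (j' : {rmorphism E' -> L'}),
          (forall x, j' (i' (i1 x)) = l (j x)) /\ aniso_mx (map_mx l (pfister_mx b' a'))].
Proof.
(* In the rotated order [z 0] is [f0] plus a generic combination of the basis vectors of index at
   least 2, and [z 1] is [e0]. So [T] takes the values [D] and 1 on them, and their pairing is
   [s]. *)
have [E1 [i1 [z [zS z0 zL]]]] := generic_values m T (@basis_rot E m).
have z1 : z 1%N = pfister_e0.
  rewrite zS basis_rot_map /basis_rot addn0 modnn; congr delta_mx.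
  by apply: val_inj; rewrite /= inordK.
have z00 : z 0%N 0 ord0 = 0.
  rewrite z0 => [|i /andP[i0 im]]; rewrite basis_rotE modn_small ?ltnS ?rmorph0 //.
have z01 : z 0%N 0 (lift ord0 ord0) = 1.
  rewrite z0 => [|i /andP[i0 im]]; rewrite basis_rotE modn_small ?ltnS ?rmorph1 //.
  by rewrite eqSS; case: i i0 im.
pose D := qfm (map_mx i1 T) (z 0%N).
have [E' [i' [w [w2 span dich univ]]]] := adjoin_quadratic_root s%:R D.
have ch21 : 2%N \in [pchar E1] by rewrite (fmorph_pchar i1).
have ch2' : 2%N \in [pchar E'] by rewrite (fmorph_pchar i').
pose P1 := pfister_mx (i1 \o b) (i1 a).
have T1 : map_mx i1 T = twist_mx s P1 (i1 a) (i1 g) by rewrite twist_mx_map pfister_mx_map.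
exists E1, E', i1, i', w, D; split.
- by split=> //; case: dich => [|[]]; [left|right].
- pose y := map_mx i' (z 0%N); pose P := pfister_mx ((i' \o i1) \o b) ((i' \o i1) a).
  have y0 : y 0 ord0 = 0 by rewrite mxE z00 rmorph0.
  have y1 : y 0 (lift ord0 ord0) = 1 by rewrite mxE z01 rmorph1.
  have qy : qfm P y = i' (qfm P1 (z 0%N)).
    by rewrite -qfm_map /P1 pfister_mx_map.
  have defD : i' D = qfm P y + (if s then i' (i1 g) else i' (i1 a) + i' (i1 g)).
    by rewrite qy /D T1 qfm_twist z00 z01 expr1n; case: (s);
      rewrite !mulr1 !rmorphD ?rmorph0 ?add0r.
  have be v : bfm P v pfister_e0 = v 0 (lift ord0 ord0) by apply: bfm_e0.
  have bf v : bfm P v pfister_f0 = v 0 ord0 by apply: bfm_f0.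
  have qe : qfm P pfister_e0 = 1 by apply: qfm_e0.
  have qf : qfm P pfister_f0 = (i' \o i1) a by apply: qfm_f0.
  (* The term [w e0] adds [w ^+ 2 + w], turning the equation of [w] into [P = g]. In the inseparable
     case [f0] cancels coordinate 1, hence the pairing with [e0]. *)
  exists (y + w *: pfister_e0 + (if s then 0 else pfister_f0)).
  rewrite pfister_mx_map -/P; rewrite rmorph_nat in w2.
  case: (s) w2 defD => /= w2 defD; rewrite ?addr0; split.
  + rewrite qfmD qfmZ bfmZr qe be y1 w2 defD.
    have -> : qfm P y + (1 * w + (qfm P y + i' (i1 g))) * 1 + w * 1 =
      (qfm P y + qfm P y) + (w + w) + i' (i1 g) by ring.
    by rewrite !(char2_dbl ch2') !add0r.
  + by rewrite bfmDl bfmZl !be y1 !mxE /= mulr0 addr0.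
  + rewrite !qfmD qfmZ bfmDl bfmZl bfmZr qe qf be !bf.
    rewrite y1 y0 w2 defD !mxE /=.
    set q := qfm P y; set a' := i' (i1 a); set g' := i' (i1 g).
    transitivity ((q + q) + (w + w) + (a' + a') + g'); first by ring.
    by rewrite !(char2_dbl ch2') !add0r.
  + by rewrite !bfmDl bfmZl !be y1 !mxE /= mulr0 addr0 (char2_dbl ch2').
- move=> c g' /(no_root_aniso _ _ ch2) aQ.
  have [L1 [l [j1 [j1l desc]]]] := zL E idfun.
  have [aQ' _] := desc _ _ aQ.
  apply/(no_root_aniso _ _ ch21); apply: (@aniso_map _ _ j1).
  congr aniso_mx: aQ'; apply/matrixP => r t; rewrite !mxE.
  by rewrite !(rmorphD, rmorphM, rmorph_nat) !j1l.
move=> L j b' a' b'0 aQ nrL.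
have [L1 [l [j1 [j1l desc]]]] := zL L j.
have [aQ1 emb] := desc _ _ aQ.
have [L' [l' [w' [w'2 span' dich' _]]]] := adjoin_quadratic_root s%:R (j1 D).
pose lj : {rmorphism E1 -> L'} := l' \o j1.
have root' : w' ^+ 2 = lj s%:R * w' + lj D by rewrite w'2 /= !rmorph_nat.
have [j' j'E] := univ _ _ _ root'.
exists L', (l' \o l), j'; split=> [x|]; first by rewrite j'E /= j1l.
have -> : map_mx (l' \o l) (pfister_mx b' a') = map_mx l' (map_mx l (pfister_mx b' a')).
  by apply/matrixP => r t; rewrite !mxE.
case: dich' => [sur|[_ indep]]; first exact: aniso_map_surj.
apply: (aniso_quad_extend w'2 span' _ indep) => v u qv bv.
have [u0|u0] := eqVneq u 0.
  by split=> //; apply: aQ1; move: qv; rewrite u0 qfm0 mulr0 addr0.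
have lb'0 : forall r, (l \o b') r != 0 by move=> r; rewrite fmorph_eq0.
rewrite pfister_mx_map in aQ1 emb qv bv.
set Q1 := pfister_mx (l \o b') (l a') in aQ1 emb qv bv.
have ch2L : 2%N \in [pchar L1] by rewrite (fmorph_pchar l) (fmorph_pchar j).
have qu : qfm Q1 u != 0 by apply: contra_neq u0 => /aQ1.
(* A zero [v + w' u] over [L'] is rescaled by roundness so that [u] gets value 1. Then [v] gets
   value [D] and the pairing becomes [s]: these are the data of [z 0], [z 1], and descent embeds [T]
   into [Q] over [L]. *)
have [S qS] := pfister_round ch2L lb'0 qu.
have uS := sim_unit ch2L lb'0 qu qS.
have qS' := sim_inv uS qu qS; have bS' := sim_bfm qS'.
have [] := emb 1%N (fun n => if n is 0 then v *m invmx S else u *m invmx S); last first.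
  rewrite addn1 => w'' /(twist_embedding b'0); case; exact: nrL.
have s0 : j1 s%:R = s%:R by rewrite rmorph_nat.
have ch2E1 x : x = - x :> L1 by rewrite (oppr_pchar2 ch2L).
have qv1 : qfm Q1 (v *m invmx S) = qfm (map_mx j1 (map_mx i1 T)) (map_mx j1 (z 0%N)).
  by rewrite qfm_map -/D qS'; apply: (mulfI qu); rewrite mulVKf // mulrC;
    apply/eqP; rewrite [X in _ == X]ch2E1 -addr_eq0 qv.
have qu1 : qfm Q1 (u *m invmx S) = qfm (map_mx j1 (map_mx i1 T)) (map_mx j1 (z 1%N)).
  rewrite qfm_map T1 z1 qfm_twist qfm_e0 // qS' mulVf // !mxE /=.
  by case: (s); rewrite !(mulr0, expr0n, addr0) rmorph1.
have bvu : bfm Q1 (v *m invmx S) (u *m invmx S) =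
    bfm (map_mx j1 (map_mx i1 T)) (map_mx j1 (z 0%N)) (map_mx j1 (z 1%N)).
  rewrite bfm_map T1 z1 bfm_twist // bfm_e0 // z00 z01 !mxE /= bS'.
  apply: (mulfI qu); rewrite mulVKf //.
  transitivity (s%:R * qfm Q1 u); last first.
    rewrite mulrC; congr (_ * _); case: (s); rewrite ?addr0 ?rmorph1 //.
    by rewrite mulr0 add0r mulr1 (char2_dbl ch21) (rmorph0 j1).
  by apply/eqP; rewrite [X in _ == X]ch2E1 -addr_eq0; apply/eqP.
move=> [|[|//]] _; split=> // [[|[|//]]] _ //=.
- by rewrite !bfmvv qv1.
- by rewrite bfmC bvu bfmC.
- by rewrite !bfmvv qu1.
Qed.

End Step.

Lemma map_mx_comp_eq (E F L : fieldType) (f : {rmorphism F -> L}) (g : {rmorphism E -> F})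
    (h : {rmorphism E -> L}) m n (A : 'M[E]_(m, n)) :
  (forall x, h x = f (g x)) -> map_mx h A = map_mx f (map_mx g A).
Proof. by move=> e; apply/matrixP => i j; rewrite !mxE e. Qed.

Section Step.

Variables (F : fieldType) (k : nat) (s : bool) (g2 : F).
Hypotheses (ch2 : 2%N \in [pchar F]).

(* [s] is the kind of quadratic extensions that are to split, the other kind is the
   one whose instance X^2 = (~~ s) X + g2 is kept anisotropic. *)
Definition keeps N (P P' : 'M[F]_N) (E : fieldType) (i : {rmorphism F -> E}) :=
  [/\ aniso_mx (map_mx i P), no_root (~~ s)%:R (i g2) &
      aniso_quad (map_mx i P') (~~ s)%:R (i g2)].

(** Either X^2 = sX + g defines no quadratic extension, or [v + t e0] is a zero of [P] over the
    extension by a root [t]. *)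
Definition splits m (P : 'M[F]_m.+2) (E : fieldType) (i : {rmorphism F -> E}) (g : E) :=
  (exists r : E, r ^+ 2 = s%:R * r + g) \/
  exists v, qfm (map_mx i P) v = g /\ bfm (map_mx i P) v pfister_e0 = s%:R.

Lemma splits_map m (P : 'M[F]_m.+2) (E E' : fieldType) (i : {rmorphism F -> E})
    (j : {rmorphism E -> E'}) (i' : {rmorphism F -> E'}) g :
  (forall x, i' x = j (i x)) -> splits P i g -> splits P i' (j g).
Proof.
move=> e [[r rg]|[v [qv bv]]]; [left|right].
  by exists (j r); rewrite -rmorphXn rg rmorphD rmorphM rmorph_nat.
exists (map_mx j v); rewrite (map_mx_comp_eq _ e) qfm_map qv; split=> //.
by rewrite -(map_delta_mx j) bfm_map bv rmorph_nat.
Qed.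

Variables (b b' bt : 'I_k.+1 -> F) (a a' ct : F).
Hypotheses (b0 : forall i, b i != 0) (b'0 : forall i, b' i != 0) (bt0 : forall i, bt i != 0).
Local Notation P := (pfister_mx b a).
Local Notation P' := (pfister_mx b' a').
Local Notation Pt := (pfister_mx bt ct).

(** [Pt] is the form to be split. The generic extension keeps [P] anisotropic when compared with
    [E], and [P'] when compared with the quadratic extension [L] of the other kind, where X^2 = sX +
    g still has no root; the result for [P'] is then restricted from the extension of [L]. *)
Lemma split_one (E : fieldType) (i : {rmorphism F -> E}) (g : E) : keeps P P' i ->
  exists (E' : fieldType) (j : {rmorphism E -> E'}) (i' : {rmorphism F -> E'}),
    [/\ forall x, i' x = j (i x), keeps P P' i' & splits Pt i' (j g)].
Proof.
move=> [aP nr2 aP']; have ch2E : 2%N \in [pchar E] by rewrite (fmorph_pchar i).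
have [nr|] := pselect (no_root s%:R g); last first.
  move=> /existsNP[x /negP/negPn/eqP rx]; exists E, idfun, i; split=> //.
  by left; exists x.
have it0 : forall r, (i \o bt) r != 0 by move=> r; rewrite fmorph_eq0.
have [E1 [E' [i1 [i' [w [D [[w2 span dich] [v [qv bv]] keep1 ext]]]]]]] :=
  generic_representation s ch2E (i ct) g it0.
pose j : {rmorphism E -> E'} := i' \o i1.
pose iE' : {rmorphism F -> E'} := j \o i.
have ext' (L : fieldType) (l : {rmorphism E -> L}) (c : 'I_k.+1 -> F) d :
    (forall r, c r != 0) -> aniso_mx (map_mx (l \o i) (pfister_mx c d)) -> no_root s%:R (l g) ->
    exists (L' : fieldType) (l' : {rmorphism L -> L'}) (j' : {rmorphism E' -> L'}),
      (forall x, j' (j x) = l' (l x)) /\ aniso_mx (map_mx j' (map_mx iE' (pfister_mx c d))).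
  move=> c0 aQ nrL; have lc0 r : ((l \o i) \o c) r != 0 by rewrite fmorph_eq0.
  have [|L' [l' [j' [jl aQ']]]] := ext L l _ ((l \o i) d) lc0 _ nrL.
    by rewrite -pfister_mx_map.
  exists L', l', j'; split=> //; rewrite -(pfister_mx_map (l \o i)) in aQ'.
  by congr aniso_mx: aQ'; apply/matrixP => r t; rewrite !mxE /= jl.
have nr2' : no_root (~~ s)%:R (iE' g2).
  apply: (@no_root_quadratic_ext _ _ i' w (~~ s) D) => //.
  - by rewrite (fmorph_pchar i1).
  - by rewrite negbK.
  by have := keep1 _ _ nr2; rewrite rmorph_nat.
exists E', j, iE'; split=> //; last first.
  right; exists v; suff -> : map_mx iE' Pt = map_mx (i' \o i1) (pfister_mx (i \o bt) (i ct)).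
    by [].
  by rewrite -pfister_mx_map; apply/matrixP => r u; rewrite !mxE.
split=> //.
  have [L' [l' [j' [_ aQ']]]] := ext' E idfun b a b0 aP nr.
  exact: aniso_map aQ'.
have [L [l [t [t2 spanL dichL _]]]] := adjoin_quadratic_root (~~ s)%:R (i g2).
have {dichL} indep : forall r u, l r + l u * t = 0 -> r = 0 /\ u = 0.
  case: dichL => [sur|[]//]; have [r tr] := sur t; case/eqP: (nr2 r).
  by apply: (fmorph_inj l); rewrite rmorphXn rmorphD rmorphM -tr.
have aL : aniso_mx (map_mx l (map_mx i P')) by apply: (aniso_quad_extend t2 spanL aP' indep).
have nrL : no_root s%:R (l g).
  by apply: (@no_root_quadratic_ext _ _ l t s (i g2)) => //; right.
have [|L' [l' [j' [jl aQ']]]] := ext' L l b' a' b'0 _ nrL.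
  by congr aniso_mx: aL; apply/matrixP => r u; rewrite !mxE.
apply: (@aniso_quad_restrict _ _ j' (l' t)) aQ' => //.
by rewrite -rmorphXn t2 rmorphD rmorphM !rmorph_nat /= jl.
Qed.

End Step.

(** * Ultraproducts and unions of chains *)

Lemma quotient_field (D : comNzRingType) (I : D -> Prop) :
  I 0 -> ~ I 1 -> (forall x y, I x -> I y -> I (x - y)) -> (forall x y, I y -> I (x * y)) ->
  (forall x, ~ I x -> exists y, I (y * x - 1)) ->
  exists (K : fieldType) (pi : {rmorphism D -> K}),
    (forall x, exists d, x = pi d) /\ forall d, pi d = 0 <-> I d.
Proof.
move=> I0 I1 IB IM IV.
pose J d := `[< I d >].
have J_closed : idealr_closed J.
  split; first exact/asboolP.
    by rewrite unfold_in; apply/asboolP.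
  move=> a u v /asboolP Iu /asboolP Iv; apply/asboolP.
  by rewrite -[v]opprK; apply: (IB); [apply: IM|rewrite -sub0r; apply: IB].
pose J' : idealr D := HB.pack J (isIdealr.Build D J J_closed).
pose K := {ideal_quot J'}.
pose pi : {rmorphism D -> K} := \pi_K%qT.
have piI d : pi d = 0 <-> I d.
  rewrite -(rmorph0 pi); split=> [/eqP|Id].
    by rewrite -Quotient.idealrBE subr0 => /asboolP.
  by apply/eqP; rewrite -Quotient.idealrBE subr0; apply/asboolP.
have pi_sur x : exists d, x = pi d by exists (repr x); rewrite [RHS]reprK.
have [x|inv invP] := @choice K K (fun x y => (x = 0 -> y = 0) /\ (x != 0 -> y * x = 1)).
  have [->|x0] := eqVneq x 0; first by exists 0.
  have [d dx] := pi_sur x; have /IV[e /piI] : ~ I d.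
    by move/piI => pd; move/eqP: x0; rewrite dx.
  rewrite rmorphB rmorphM rmorph1 -dx => /eqP; rewrite subr_eq0 => /eqP ex.
  by exists (pi e); split=> // x00; rewrite x00 eqxx in x0.
have mulV x : x != 0 -> inv x * x = 1 by case: (invP x).
have inv0 : inv 0 = 0 by case: (invP 0) => /(_ erefl).
pose KF : fieldType := HB.pack K (GRing.ComNzRing_isField.Build K mulV inv0).
by exists KF, pi.
Qed.

Section CoherentProduct.

Variables (I : Type) (i0 : I) (E : I -> fieldType) (S : (forall i, E i) -> Prop).

(** One construction serves both limits: [S] contains all families for ultraproducts, and the
    eventually compatible sequences for unions of chains. *)
Definition coherent_closed :=
  [/\ S (fun=> 1), forall f g, S f -> S g -> S (fun i => f i - g i) &
      forall f g, S f -> S g -> S (fun i => f i * g i)].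

(** The index ensures that 1 differs from 0 in the product ring. *)
Definition cprod of I & coherent_closed := {f | S f}.

Hypothesis S_closed : coherent_closed.
Local Notation D := (cprod i0 S_closed).

HB.instance Definition _ := gen_eqMixin D.
HB.instance Definition _ := gen_choiceMixin D.

Definition cval (d : D) : forall i, E i := sval d.

Lemma cval_inj d d' : (forall i, cval d i = cval d' i) -> d = d'.
Proof.
case: d d' => [f Sf] [g Sg] /= e; apply: eq_exist.
exact: functional_extensionality_dep.
Qed.

Lemma coherent1 : S (fun=> 1). Proof. by case: S_closed. Qed.
Lemma coherentB f g : S f -> S g -> S (fun i => f i - g i). Proof. by case: S_closed => _ + _;
  apply. Qed.
Lemma coherentM f g : S f -> S g -> S (fun i => f i * g i). Proof. by case: S_closed => _ _;
  apply. Qed.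
Lemma coherent0 : S (fun=> 0).
Proof. by have := coherentB coherent1 coherent1; congr S;
  apply: functional_extensionality_dep => i; rewrite subrr. Qed.
Lemma coherentN f : S f -> S (fun i => - f i).
Proof. by move/(coherentB coherent0); congr S; apply: functional_extensionality_dep => i;
  rewrite sub0r. Qed.
Lemma coherentD f g : S f -> S g -> S (fun i => f i + g i).
Proof.
by move=> Sf /coherentN/(coherentB Sf); congr S; apply: functional_extensionality_dep => i;
  rewrite opprK.
Qed.

Definition cprod0 : D := exist _ _ coherent0.
Definition cprod1 : D := exist _ _ coherent1.
Definition cprodN (d : D) : D := exist _ _ (coherentN (svalP d)).
Definition cprodD (d e : D) : D := exist _ _ (coherentD (svalP d) (svalP e)).
Definition cprodM (d e : D) : D := exist _ _ (coherentM (svalP d) (svalP e)).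

Lemma cprod_addA : associative cprodD.
Proof. by move=> x y z; apply: cval_inj => i; apply: addrA. Qed.
Lemma cprod_addC : commutative cprodD.
Proof. by move=> x y; apply: cval_inj => i; apply: addrC. Qed.
Lemma cprod_add0 : left_id cprod0 cprodD.
Proof. by move=> x; apply: cval_inj => i; apply: add0r. Qed.
Lemma cprod_addN : left_inverse cprod0 cprodN cprodD.
Proof. by move=> x; apply: cval_inj => i; apply: addNr. Qed.

HB.instance Definition _ := GRing.isZmodule.Build D cprod_addA cprod_addC cprod_add0 cprod_addN.

Lemma cprod_mulA : associative cprodM.
Proof. by move=> x y z; apply: cval_inj => i; apply: mulrA. Qed.
Lemma cprod_mulC : commutative cprodM.
Proof. by move=> x y; apply: cval_inj => i; apply: mulrC. Qed.
Lemma cprod_mul1 : left_id cprod1 cprodM.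
Proof. by move=> x; apply: cval_inj => i; apply: mul1r. Qed.
Lemma cprod_mulD : left_distributive cprodM +%R.
Proof. by move=> x y z; apply: cval_inj => i; apply: mulrDl. Qed.
Lemma cprod_1neq0 : cprod1 != 0.
Proof.
by apply/eqP => /(congr1 (fun d => cval d i0)) /= /eqP; rewrite oner_eq0.
Qed.

HB.instance Definition _ := GRing.Zmodule_isComNzRing.Build D
  cprod_mulA cprod_mulC cprod_mul1 cprod_mulD cprod_1neq0.

Definition cev (i : I) (d : D) : E i := cval d i.
Lemma cev_zmod i : zmod_morphism (cev i). Proof. by []. Qed.
Lemma cev_monoid i : monoid_morphism (cev i). Proof. by []. Qed.
HB.instance Definition _ i := GRing.isZmodMorphism.Build D (E i) (cev i) (cev_zmod i).
HB.instance Definition _ i := GRing.isMonoidMorphism.Build D (E i) (cev i) (cev_monoid i).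

Variable Fil : (I -> Prop) -> Prop.
Hypotheses (FilT : Fil (fun=> True)) (FilS : forall P Q : I -> Prop, (forall i, P i -> Q i) ->
  Fil P -> Fil Q)
  (FilI : forall P Q : I -> Prop, Fil P -> Fil Q -> Fil (fun i => P i /\ Q i))
  (Fil_ex : forall P, Fil P -> exists i, P i)
  (SV : forall f, S f -> S (fun i => (f i)^-1))
  (S_dec : forall f, S f -> Fil (fun i => f i = 0) \/ Fil (fun i => f i <> 0)).

(** The families vanishing on a set of [Fil] form a maximal ideal: by [S_dec] any other family is
    nonzero on such a set, where its coordinatewise inverse works. *)
Lemma coherent_product : exists (D : comNzRingType) (ev : forall i, {rmorphism D -> E i})
    (K : fieldType) (pi : {rmorphism D -> K}),
  [/\ forall f, S f -> exists d, forall i, ev i d = f i, forall d, S (fun i => ev i d),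
      forall d d', (forall i, ev i d = ev i d') -> d = d',
      forall x, exists d, x = pi d & forall d, pi d = 0 <-> Fil (fun i => ev i d = 0)].
Proof.
have [] := @quotient_field D (fun d => Fil (fun i => cev i d = 0)).
- exact: FilS FilT.
- by move=> /Fil_ex[i /eqP]; rewrite -[cev i 1]/(1 : E i) oner_eq0.
- move=> x y Fx /(FilI Fx); apply: FilS => i [x0 y0].
  by rewrite -[LHS]/(cev i x - cev i y) x0 y0 subrr.
- by move=> x y; apply: FilS => i y0; rewrite -[LHS]/(cev i x * cev i y) y0 mulr0.
- move=> x nx; exists (exist _ _ (SV (svalP x))).
  have [//|] := S_dec (svalP x); apply: FilS => i /eqP xi.
  by apply/eqP; rewrite subr_eq0; apply/eqP/mulVf.
move=> K [pi [pi_sur piE]]; exists D, (fun i => cev i : {rmorphism D -> E i}), K, pi.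
split=> //; first by move=> f Sf; exists (exist _ _ Sf).
  exact: svalP.
exact: cval_inj.
Qed.

End CoherentProduct.

Lemma product_morphism (I : Type) (E : I -> fieldType) (D : comNzRingType)
    (ev : forall i, {rmorphism D -> E i}) (F : fieldType) (h : forall i, {rmorphism F -> E i}) :
  (forall d d', (forall i, ev i d = ev i d') -> d = d') ->
  (forall x, exists d, forall i, ev i d = h i x) ->
  exists h' : {rmorphism F -> D}, forall i x, ev i (h' x) = h i x.
Proof.
move=> ev_inj /choice[f fE].
have fz : zmod_morphism f by move=> x y; apply: ev_inj => i; rewrite rmorphB !fE rmorphB.
have fm : monoid_morphism f.
  by split=> [|x y]; apply: ev_inj => i; rewrite ?rmorphM !fE ?rmorphM ?rmorph1.
pose m1 := GRing.isZmodMorphism.Build _ _ f fz.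
pose m2 := GRing.isMonoidMorphism.Build _ _ f fm.
by exists (HB.pack f m1 m2 : {rmorphism F -> D}).
Qed.

Lemma choice_dep (X : Type) (Y : X -> Type) (Q : forall x, Y x -> Prop) :
  (forall x, exists y, Q x y) -> exists f : forall x, Y x, forall x, Q x (f x).
Proof. by move=> ex; exists (fun x => sval (cid (ex x))) => x; apply: svalP. Qed.

Section KeepsProduct.

Variables (I : Type) (E : I -> fieldType) (D : comNzRingType) (ev : forall i, {rmorphism D -> E
  i}).
Variables (K : fieldType) (pi : {rmorphism D -> K}) (Fil : (I -> Prop) -> Prop).
Hypotheses (FilS : forall P Q : I -> Prop, (forall i, P i -> Q i) -> Fil P -> Fil Q)
  (FilI : forall P Q : I -> Prop, Fil P -> Fil Q -> Fil (fun i => P i /\ Q i))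
  (Fil_ex : forall P, Fil P -> exists i, P i).
Hypotheses (pi_sur : forall x, exists d, x = pi d) (pi0 : forall d, pi d = 0 <-> Fil (fun i =>
  ev i d = 0)).

Lemma pi_eq d e : pi d = pi e <-> Fil (fun i => ev i d = ev i e).
Proof.
split=> [de|F]; [have /pi0 : pi (d - e) = 0 by rewrite rmorphB de subrr|].
  by apply: FilS => i; rewrite rmorphB => /eqP; rewrite subr_eq0 => /eqP.
suff : pi (d - e) = 0 by rewrite rmorphB => /eqP; rewrite subr_eq0 => /eqP.
by apply/pi0; apply: FilS F => i e'; rewrite rmorphB e' subrr.
Qed.

Lemma pi_row N (v : 'rV[K]_N) : exists V, v = map_mx pi V.
Proof.
have [V vV] := fin_all_exists (fun j => pi_sur (v 0 j)).
by exists (\row_j V j); apply/rowP => j; rewrite !mxE.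
Qed.

Variables (F : fieldType) (h : forall i, {rmorphism F -> E i}) (h' : {rmorphism F -> D}).
Hypothesis h'E : forall i x, ev i (h' x) = h i x.
Variables (iota : {rmorphism F -> K}).
Hypothesis iotaE : forall x, iota x = pi (h' x).

Lemma map_iota m n (A : 'M[F]_(m, n)) : map_mx iota A = map_mx pi (map_mx h' A).
Proof. by apply/matrixP => i j; rewrite !mxE. Qed.

Lemma map_ev i m n (A : 'M[F]_(m, n)) : map_mx (ev i) (map_mx h' A) = map_mx (h i) A.
Proof. by apply/matrixP => a b; rewrite !mxE. Qed.

(** Vectors have finitely many coordinates, so they lift to [D], and every clause can be checked
    index by index on a set of [Fil]. *)
Lemma keeps_product s g N (P P' : 'M[F]_N) :
  (forall i, keeps s g P P' (h i)) -> keeps s g P P' iota.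
Proof.
move=> kh; split=> [v|x|v w].
- have [V ->] := pi_row v; rewrite map_iota qfm_map => /pi0 q0.
  apply/rowP => c; rewrite !mxE; apply/pi0; apply: FilS q0 => i.
  rewrite -qfm_map map_ev; have [aP _ _] := kh i => /aP/rowP/(_ c).
  by rewrite !mxE.
- have [d ->] := pi_sur x; rewrite iotaE -(rmorph_nat pi) -rmorphXn -rmorphM -rmorphD.
  apply/eqP => /pi_eq/Fil_ex[i]; rewrite rmorphXn rmorphD rmorphM rmorph_nat h'E.
  by have [_ nr _] := kh i; apply/eqP/nr.
have [V ->] := pi_row v; have [W ->] := pi_row w.
rewrite map_iota !qfm_map (bfm_map pi) iotaE -(rmorph_nat pi) -!rmorphM -!rmorphD.
move=> /pi0 q0 /pi0 b0.
have vw0 : Fil (fun i => map_mx (ev i) V = 0 /\ map_mx (ev i) W = 0).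
  apply: FilS (FilI q0 b0) => i [{}q0 {}b0].
  have [_ _ aP'] := kh i; apply: aP'; rewrite -map_ev ?(bfm_map (ev i)) !qfm_map.
    by rewrite -h'E -rmorphM -rmorphD.
  by rewrite -(rmorph_nat (ev i)) -rmorphM -rmorphD.
split; apply/rowP => c; rewrite !mxE; apply/pi0;
  apply: FilS vw0 => i [/rowP/(_ c) v0 /rowP/(_ c) w0].
  by rewrite !mxE in v0.
by rewrite !mxE in w0.
Qed.

End KeepsProduct.

Lemma extend_sequence (E : nat -> fieldType) (j : forall n, E n -> E n.+1) M (x : E M) :
  exists f : forall n, E n, f M = x /\ forall n, (M <= n)%N -> f n.+1 = j n (f n).
Proof.
elim: M E j x => [|M IHM] E j x.
  by exists (nat_rect E x (fun n => j n)).
have [f [fM fS]] := IHM (fun n => E n.+1) (fun n => j n.+1) x.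
(* Entries before stage [M] are filled with 0. *)
by exists (fun n => if n is n'.+1 then f n' else 0); split=> // -[//|n] /fS.
Qed.

Section Closure.

Variables (F : fieldType) (k : nat) (s : bool) (g2 : F).
Hypotheses (ch2 : 2%N \in [pchar F]).
Variables (b b' : 'I_k.+1 -> F) (a a' : F).
Hypotheses (b0 : forall i, b i != 0) (b'0 : forall i, b' i != 0).
Local Notation P := (pfister_mx b a).
Local Notation P' := (pfister_mx b' a').
Local Notation keeps := (keeps s g2 P P').

Definition splits2 (E : fieldType) (i : {rmorphism F -> E}) (g : E) :=
  splits s P i g /\ splits s P' i g.

Lemma splits2_map (E E' : fieldType) (i : {rmorphism F -> E})
    (j : {rmorphism E -> E'}) (i' : {rmorphism F -> E'}) g :
  (forall x, i' x = j (i x)) -> splits2 i g -> splits2 i' (j g).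
Proof. by move=> e [s1 s2]; split; apply: splits_map e _. Qed.

Lemma split_list (E : fieldType) (i : {rmorphism F -> E}) (l : seq E) : keeps i ->
  exists (E' : fieldType) (j : {rmorphism E -> E'}) (i' : {rmorphism F -> E'}),
    [/\ forall x, i' x = j (i x), keeps i' & forall g, g \in l -> splits2 i' (j g)].
Proof.
move=> ki; elim: l => [|g l [E1 [j1 [i1 [i1E k1 s1]]]]].
  by exists E, idfun, i.
have [E2 [j2 [i2 [i2E k2 s2]]]] := split_one ch2 a b0 b'0 b0 (j1 g) k1.
have [E3 [j3 [i3 [i3E k3 s3]]]] := split_one ch2 a' b0 b'0 b'0 (j2 (j1 g)) k2.
exists E3, (j3 \o (j2 \o j1) : {rmorphism E -> E3}), i3.
split=> // [x|x]; first by rewrite i3E i2E i1E.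
rewrite inE => /orP[/eqP->|/s1 sx].
  by split=> //; apply: splits_map i3E s2.
by apply: (splits2_map (j := j3)) => //; apply: (splits2_map i2E).
Qed.


(* [K] is an ultraproduct, over the finite lists [l] of elements of [E], of extensions
   splitting all [g] in [l]. *)
Lemma split_all (E : fieldType) (i : {rmorphism F -> E}) : keeps i ->
  exists (K : fieldType) (J : {rmorphism E -> K}) (i' : {rmorphism F -> K}),
    [/\ forall x, i' x = J (i x), keeps i' & forall g, splits2 i' (J g)].
Proof.
move=> ki; pose ext (l : seq E) := split_list l ki.
have [E1 /choice_dep[j /choice_dep[i1 i1P]]] := choice_dep ext.
(* An ultrafilter above this filter contains, for each [g], the set of lists having [g] as a
   member. *)
pose base (A : seq E -> Prop) := exists l : seq E, forall l', {subset l <= l'} -> A l'.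
have base_filter : filter.ProperFilter base.
  split; first by case=> l /(_ l); apply.
  split; first by exists [::].
    move=> A B [l lA] [l' lB]; exists (l ++ l') => m lm; split.
      by apply: lA => x xl; apply: lm; rewrite mem_cat xl.
    by apply: lB => x xl; apply: lm; rewrite mem_cat xl orbT.
  by move=> A B AB [l lA]; exists l => m lm; apply/AB/lA.
have [G [GU baseG]] := filter.ultraFilterLemma base_filter.
have GT : G (fun=> True) by apply: filter.filterT.
have GS (A B : seq E -> Prop) : (forall l, A l -> B l) -> G A -> G B by move=> AB;
  apply: filter.filterS.
have GI (A B : seq E -> Prop) : G A -> G B -> G (fun l => A l /\ B l) by apply: filter.filterI.
have G_ex (A : seq E -> Prop) : G A -> exists l, A l by apply: filter.filter_ex.
have Gem A : G A \/ G (fun l => ~ A l) by apply: filter.in_ultra_setVsetC.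
have Gin g : G (fun l => g \in l).
  by apply: baseG; exists [:: g] => l; apply; rewrite inE.
pose S (f : forall l, E1 l) := True.
have S_closed : coherent_closed S by [].
have [//|f _|D [ev [K [pi [Sev _ ev_inj pi_sur pi0]]]]] :=
  @coherent_product _ [::] E1 S S_closed G GT GS GI G_ex.
  exact: Gem.
have {}Sev f : exists d, forall l, ev l d = f l by apply: Sev.
have [h' h'E] := @product_morphism _ _ _ ev E j ev_inj (fun x => Sev (fun l => j l x)).
pose J : {rmorphism E -> K} := pi \o h'.
pose i' : {rmorphism F -> K} := J \o i.
have evi l x : ev l ((h' \o i) x) = i1 l x by have [-> _ _] := i1P l; rewrite -h'E.
have mapP N (A : 'M[F]_N) : map_mx i' A = map_mx pi (map_mx (h' \o i) A).
  by apply/matrixP => r c; rewrite !mxE.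
have mapE l N (A : 'M[F]_N) : map_mx (ev l) (map_mx (h' \o i) A) = map_mx (i1 l) A.
  by apply/matrixP => r c; rewrite !mxE -evi.
exists K, J, i'; split=> //.
  apply: (keeps_product GS GI G_ex pi_sur pi0 (h := i1) (h' := h' \o i)) => // l.
  by have [] := i1P l.
have pi_eq := pi_eq GS pi0.
have spl (A : 'M[F]_(pN k.+1)) g : G (fun l => splits s A (i1 l) (j l g)) -> splits s A i' (J g).
  (* The ultrafilter decides between [B] and its complement, so the same alternative of [splits]
     holds for almost all lists and its witnesses can be assembled. *)
  move=> Gs; pose B l := exists r : E1 l, r ^+ 2 = s%:R * r + j l g.
  have [GB|GB] := Gem B; [left|right].
    have [l|r rP] := @choice_dep _ _ (fun l (r : E1 l) => B l -> r ^+ 2 = s%:R * r + j l g).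
      by have [[r rl]|nB] := pselect (B l); [exists r|exists 0].
    have [d dr] := Sev r; exists (pi d).
    rewrite -(rmorph_nat pi) -rmorphXn -rmorphM -rmorphD; apply/pi_eq.
    by apply: GS GB => l /rP; rewrite -dr rmorphXn rmorphD rmorphM rmorph_nat h'E.
  have [l|V VP] := @choice_dep _ _ (fun l (V : 'rV[E1 l]_(pN k.+1)) => splits s A (i1 l) (j l g)
    -> ~ B l ->
      qfm (map_mx (i1 l) A) V = j l g /\ bfm (map_mx (i1 l) A) V pfister_e0 = s%:R).
    have [[//|[V VP]]|nB] := pselect (splits s A (i1 l) (j l g));
      [by exists 0|by exists V|by exists 0].
  have [W WP] := fin_all_exists (fun c => Sev (fun l => V l 0 c)).
  have evW l : map_mx (ev l) (\row_c W c) = V l by apply/rowP => c; rewrite !mxE.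
  exists (map_mx pi (\row_c W c)); rewrite mapP -(map_delta_mx pi) -(rmorph_nat pi) qfm_map
    (bfm_map pi).
  split; apply/pi_eq; apply: GS (GI _ _ Gs GB) => l [/VP + /[dup] + +] => VPl nB.
    by rewrite -qfm_map mapE evW h'E; case: (VPl nB).
  by rewrite -(bfm_map (ev l)) mapE evW map_delta_mx rmorph_nat; case: (VPl nB).
by move=> g; split; apply: spl; apply: GS (Gin g) => l gl; have [_ _ /(_ g gl)[]] := i1P l.
Qed.


(* [K] is the union of a chain of extensions, each of which splits all the elements of
   the previous one. *)
Lemma split_closure (E0 : fieldType) (i0 : {rmorphism F -> E0}) : keeps i0 ->
  exists (K : fieldType) (i : {rmorphism F -> K}), keeps i /\ forall g, splits2 i g.
Proof.
move=> k0; pose St := {E : fieldType & {i : {rmorphism F -> E} | keeps i}}.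
pose fld (x : St) : fieldType := projT1 x.
pose mor (x : St) : {rmorphism F -> fld x} := sval (projT2 x).
have next (x : St) : exists y : St, exists j : {rmorphism fld x -> fld y},
    (forall z, mor y z = j (mor x z)) /\ forall g, splits2 (mor y) (j g).
  case: x => E [i ki]; have [K [J [i' [i'E ki' sp]]]] := split_all ki.
  by exists (existT _ K (exist _ i' ki')), J.
have [nxt nxtP] := choice_dep next.
have [j jP] := choice_dep nxtP.
pose st n := iter n nxt (existT _ E0 (exist _ i0 k0)).
pose E n := fld (st n); pose h n : {rmorphism F -> E n} := mor (st n).
pose jj n : {rmorphism E n -> E n.+1} := j (st n).
have hS n x : h n.+1 x = jj n (h n x) by case: (jP (st n)).
have spS n g : splits2 (h n.+1) (jj n g) by case: (jP (st n)) => _; apply.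
have kh n : keeps (h n) by apply: (svalP (projT2 (st n))).
pose coh N (f : forall n, E n) := forall n, (N <= n)%N -> f n.+1 = jj n (f n).
pose S f := exists N, coh N f.
have cohW N N' f : (N <= N')%N -> coh N f -> coh N' f.
  by move=> le cf n le'; apply: cf; apply: leq_trans le'.
have S_closed : coherent_closed S.
  split; first by exists 0%N => n _; rewrite rmorph1.
    move=> f g [N cf] [N' cg]; exists (maxn N N') => n; rewrite geq_max => /andP[le le'].
    by rewrite cf // cg // rmorphB.
  move=> f g [N cf] [N' cg]; exists (maxn N N') => n; rewrite geq_max => /andP[le le'].
  by rewrite cf // cg // rmorphM.
(* Tails suffice here, since transition maps are injective: a coherent sequence is eventually zero
   or eventually nonzero. *)
pose Fil (A : nat -> Prop) := exists N, forall n, (N <= n)%N -> A n.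
have FilT : Fil (fun=> True) by exists 0%N.
have FilS (A B : nat -> Prop) : (forall n, A n -> B n) -> Fil A -> Fil B.
  by move=> AB [N NA]; exists N => n /NA/AB.
have FilI (A B : nat -> Prop) : Fil A -> Fil B -> Fil (fun n => A n /\ B n).
  move=> [N NA] [N' NB]; exists (maxn N N') => n; rewrite geq_max => /andP[le le'].
  by split; [apply: NA|apply: NB].
have Fil_ex (A : nat -> Prop) : Fil A -> exists n, A n by move=> [N NA]; exists N; apply: NA.
have [||D [ev [K [pi [Sev evS ev_inj pi_sur pi0]]]]] :=
  @coherent_product _ 0%N E S S_closed Fil FilT FilS FilI Fil_ex.
- by move=> f [N cf]; exists N => n le; rewrite cf // fmorphV.
- move=> f [N cf]; have [fN|fN] := eqVneq (f N) 0; [left|right]; exists N.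
    move=> n; elim: n => [|n IHn]; first by rewrite leqn0 => /eqP N0; rewrite N0 in fN.
    by rewrite leq_eqVlt => /orP[/eqP eN|lt]; [rewrite -eN|rewrite cf // IHn // rmorph0].
  move=> n le; apply/eqP; elim: n le => [|n IHn]; first by rewrite leqn0 => /eqP N0;
    rewrite N0 in fN.
  by rewrite leq_eqVlt => /orP[/eqP eN|lt]; [rewrite -eN|rewrite cf // fmorph_eq0 IHn].
have pi_eq d e : pi d = pi e <-> Fil (fun n => ev n d = ev n e) by apply: (pi_eq FilS pi0).
have coh_eq N d e : coh N (fun n => ev n d) -> coh N (fun n => ev n e) ->
    ev N d = ev N e -> pi d = pi e.
  move=> cd ce de; apply/pi_eq; exists N => n; elim: n => [|n IHn].
    by rewrite leqn0 => /eqP N0; rewrite N0 in de.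
  rewrite leq_eqVlt => /orP[/eqP eN|lt]; first by rewrite eN in de.
  by rewrite cd // ce // IHn.
have [h' h'E] : exists h' : {rmorphism F -> D}, forall n x, ev n (h' x) = h n x.
  apply: (product_morphism (h := h)) => // x; apply: (Sev (fun n => h n x)).
  by exists 0%N => n _; apply: hS.
pose i : {rmorphism F -> K} := pi \o h'.
(* The canonical map of stage [M] into the union extends an element to a sequence coherent from [M]
   on. *)
have emb M : exists e : {rmorphism E M -> K},
    forall d, coh M (fun n => ev n d) -> e (ev M d) = pi d.
  have [x|t tP] := @choice (E M) D (fun x d => ev M d = x /\ coh M (fun n => ev n d)).
    have [f [fM cf]] := extend_sequence jj x.
    have [|d df] := Sev f; first by exists M.
    by exists d; rewrite df fM; split=> // n le; rewrite !df cf.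
  have tE x : ev M (t x) = x by case: (tP x).
  have tc x : coh M (fun n => ev n (t x)) by case: (tP x).
  have ez : zmod_morphism (pi \o t).
    move=> x y; rewrite /= -rmorphB; apply: (coh_eq M) => //.
      by move=> n le; rewrite !rmorphB !tc.
    by rewrite rmorphB !tE.
  have em : monoid_morphism (pi \o t).
    split=> [|x y]; rewrite /= -?rmorphM -?(rmorph1 pi); apply: (coh_eq M) => //.
    - by move=> n le; rewrite !rmorph1.
    - by rewrite rmorph1 tE.
    - by move=> n le; rewrite !rmorphM !tc.
    by rewrite rmorphM !tE.
  pose m1 := GRing.isZmodMorphism.Build _ _ _ ez.
  pose m2 := GRing.isMonoidMorphism.Build _ _ _ em.
  pose e : {rmorphism E M -> K} := HB.pack (pi \o t) m1 m2.
  by exists e => d cd; rewrite /e /=; apply: (coh_eq M) => //; rewrite tE.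
exists K, i; split; first exact: (keeps_product FilS FilI Fil_ex pi_sur pi0 h'E).
move=> g; have [d ->] := pi_sur g; have [N cd] := evS d.
have [e eP] := emb N.+1.
(* The element [g] comes from stage [N], and stage [N.+1] splits it. *)
have <- : e (jj N (ev N d)) = pi d by rewrite -(cd N) // eP //; apply: cohW cd.
apply: (splits2_map _ (spS N (ev N d))) => x.
by rewrite -h'E eP // => n _; rewrite !h'E hS.
Qed.

End Closure.

(** * Isometries, scalar extensions and hyperbolicity *)

Lemma mxformP (F : fieldType) N (Q : 'M[F]_N) : quadratic_map (qfm Q).
Proof.
split=> [a v|a u v w]; first exact: qfmZ.
by rewrite /polar -!bfm_qfm bfmDl bfmZl.
Qed.

Definition mxform (F : fieldType) N (Q : 'M[F]_N) : qform 'rV[F]_N := QForm (mxformP Q).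

Section Isometries.

Variable F : fieldType.
Implicit Types U V W : vectType F.

Lemma isometric_sym V W (q : qform V) (q' : qform W) : isometric q q' -> isometric q' q.
Proof.
move=> [f [[g fK gK] qf]].
have gl : linear g.
  by move=> a u v; apply: (can_inj fK); rewrite linearP !gK.
pose m := GRing.isLinear.Build _ _ _ _ g gl.
exists (HB.pack g m : {linear W -> V}); split; first by exists f.
by move=> v; rewrite -qf /= gK.
Qed.

Lemma isometric_trans U V W (q : qform U) (q' : qform V) (q'' : qform W) :
  isometric q q' -> isometric q' q'' -> isometric q q''.
Proof.
move=> [f [bf qf]] [g [bg qg]]; exists (g \o f : {linear U -> W}).
by split=> [|v]; [apply: bij_comp|rewrite /= qg qf].
Qed.

Lemma isometric_anisotropic V W (q : qform V) (q' : qform W) :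
  isometric q q' -> anisotropic q -> anisotropic q'.
Proof.
move=> [f [[g fK gK] qf]] aq [w [w0 qw]]; apply: aq; exists (g w).
split; last by rewrite -qf gK.
by apply: contra_neq w0 => gw; rewrite -[w]gK gw linear0.
Qed.

Lemma isometric_hyperbolic V W (q : qform V) (q' : qform W) :
  isometric q q' -> hyperbolic q -> hyperbolic q'.
Proof.
by move=> qq' [k qk]; exists k; apply: isometric_trans qk; apply: isometric_sym.
Qed.

Lemma anisotropic_mxform N (Q : 'M[F]_N) : anisotropic (mxform Q) <-> aniso_mx Q.
Proof.
split=> [aQ v qv|aQ [v [v0 /aQ v1]]]; last by rewrite v1 eqxx in v0.
by apply/eqP/negPn/negP => v0; apply: aQ; exists v.
Qed.

End Isometries.

Section ScalarExtension.

Variables (F E : fieldType) (iota : {rmorphism F -> E}) (V : vectType F) (q : qform V).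

(** The matrix [A] of the isometry in the basis [vbasis] stays invertible over [E], and expanding
    [Q] on its rows gives the defining formula of [scalar_ext]. *)
Lemma scalar_ext_mxform N (Q : 'M[F]_N) :
  isometric q (mxform Q) -> isometric (scalar_ext iota q) (mxform (map_mx iota Q)).
Proof.
move=> qQ; have [g [_ qg]] := isometric_sym qQ; have [f [[g' fK gK] qf]] := qQ.
pose e i := tnth (vbasis {:V}) i.
have e_sum v : v = \sum_i coord (vbasis {:V}) i v *: e i.
  rewrite [LHS](coord_vbasis (memvf v)); apply: eq_bigr => i _.
  by rewrite /e -tnth_nth.
have ce i j : coord (vbasis {:V}) i (e j) = (i == j)%:R.
  by rewrite /e (tnth_nth 0) coord_free 1?eq_sym //; have /andP[] := vbasisP {:V}.
have g'l : linear g' by move=> a u v; apply: (can_inj fK); rewrite linearP !gK.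
pose gl : {linear 'rV[F]_N -> V} := HB.pack g' (GRing.isLinear.Build _ _ _ _ g' g'l).
pose A : 'M[F]_(\dim {:V}, N) := \matrix_i f (e i).
pose B : 'M[F]_(N, \dim {:V}) := \matrix_(j, i) coord (vbasis {:V}) i (gl (delta_mx 0 j)).
have BA : B *m A = 1%:M.
  apply/row_matrixP => j; rewrite row_mul mulmx_sum_row row1 -[RHS]gK [in RHS](e_sum (g' _)).
  by rewrite linear_sum; apply: eq_bigr => i _; rewrite linearZ !mxE rowK.
have AB : A *m B = 1%:M.
  apply/matrixP => i i'; rewrite !mxE eq_sym -ce -[e i]fK [f (e i)]row_sum_delta.
  rewrite -[g' _]/(gl _) !linear_sum; apply: eq_bigr => j _.
  by rewrite linearZ /= linearZ /= !mxE.
have mapAB : map_mx iota A *m map_mx iota B = 1%:M by rewrite -map_mxM AB map_mx1.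
have mapBA : map_mx iota B *m map_mx iota A = 1%:M by rewrite -map_mxM BA map_mx1.
exists (mulmxr (map_mx iota A) : {linear 'rV_(\dim {:V}) -> 'rV_N}); split.
  by exists (mulmxr (map_mx iota B)) => v /=; rewrite -mulmxA ?mapAB ?mapBA mulmx1.
move=> v; rewrite [X in mxform _ X]mulmx_sum_row quadratic_map_expand.
have rA i : row i (map_mx iota A) = map_mx iota (f (e i)) by rewrite -map_row rowK.
congr (_ + _); apply: eq_bigr => i _.
  by rewrite rA /= qfm_map -[qfm Q _]/(mxform Q _) qf.
apply: eq_bigr => j _; congr (_ * _); rewrite !rA /polar /=.
by rewrite -map_mxD !qfm_map -!rmorphB -linearD -!(qf _).
Qed.

End ScalarExtension.

Section PfisterForm.

Variable F : fieldType.
Local Notation plane := (F^o * F^o)%type.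
Local Notation up J := (lift ord0 @: J).
Local Notation down I := (lift ord0 @^-1: I).

Lemma upK k (J : {set 'I_k}) : down (up J) = J.
Proof. by apply/setP => j; rewrite inE mem_imset //; apply: lift_inj. Qed.

Lemma ord0_up k (J : {set 'I_k}) : ord0 \notin up J.
Proof. by apply/imsetP => -[j _] /eqP; rewrite (negPf (neq_lift _ _)). Qed.

Lemma up1K k (J : {set 'I_k}) : down (ord0 |: up J) = J.
Proof.
apply/setP => j; rewrite !inE mem_imset; last exact: lift_inj.
by rewrite eq_sym (negPf (neq_lift _ _)).
Qed.

Lemma downK k (I : {set 'I_k.+1}) : (if ord0 \in I then ord0 |: up (down I) else up (down I)) = I.
Proof.
apply/setP => i; have [j ->|->] := unliftP ord0 i.
  have jI : (lift ord0 j \in up (down I)) = (lift ord0 j \in I).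
    by rewrite mem_imset ?inE //; apply: lift_inj.
  by case: ifP => _; rewrite ?in_setU1 jI // eq_sym (negPf (neq_lift _ _)).
by case: ifP => _; rewrite ?setU11 // (negPf (ord0_up _)).
Qed.

Lemma sum_setS k (G : {set 'I_k.+1} -> F) :
  \sum_I G I = \sum_(J : {set 'I_k}) G (up J) + \sum_(J : {set 'I_k}) G (ord0 |: up J).
Proof.
rewrite (bigID (fun I : {set 'I_k.+1} => ord0 \notin I)) /=; congr (_ + _).
  rewrite (reindex_onto (fun J : {set 'I_k} => up J) (fun I => down I)) => [|I /negPf I0].
    by apply: eq_bigl => J; rewrite ord0_up upK eqxx.
  by rewrite -[RHS]downK I0.
rewrite (reindex_onto (fun J : {set 'I_k} => ord0 |: up J) (fun I => down I)) => [|I].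
  by apply: eq_bigl => J; rewrite negbK setU11 up1K eqxx.
by rewrite negbK => I0; rewrite -[RHS]downK I0.
Qed.

(** Subsets without [ord0] fill the left block and subsets with it the right one, matching the
    recursion of [pfister_mx]. *)
Fixpoint plane_row k : ({set 'I_k} -> plane) -> 'rV[F]_(pN k) :=
  match k with
  | 0 => fun x => \row_(j < 2) if j == ord0 then (x set0).1 else (x set0).2
  | k'.+1 => fun x => row_mx (plane_row (fun J => x (up J)))
       (plane_row (fun J => x (ord0 |: up J))) : 'rV_(pN k' + pN k')
  end.

Fixpoint row_plane k : 'rV[F]_(pN k) -> {set 'I_k} -> plane :=
  match k with
  | 0 => fun v _ => (v 0 ord0, v 0 (lift ord0 ord0))
  | k'.+1 => fun (v : 'rV_(pN k' + pN k')) I =>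
      row_plane (if ord0 \in I then rsubmx v else lsubmx v) (down I)
  end.

Lemma eq_plane_row k (x y : {set 'I_k} -> plane) : x =1 y -> plane_row x = plane_row y.
Proof.
elim: k x y => [|k IHk] x y xy; first by apply/rowP => j; rewrite !mxE xy.
by apply: (congr2 (@row_mx F 1 (pN k) (pN k))); apply: IHk => J; apply: xy.
Qed.

Lemma plane_rowK k (x : {set 'I_k} -> plane) : row_plane (plane_row x) =1 x.
Proof.
elim: k x => [|k IHk] x I.
  rewrite /= !mxE /= (_ : I = set0); first by case: (x set0).
  by apply/setP => -[].
rewrite [LHS]/= row_mxKl row_mxKr -[in RHS](downK I).
by case: ifP => _; rewrite IHk.
Qed.

Lemma row_planeK k (v : 'rV[F]_(pN k)) : plane_row (row_plane v) = v.
Proof.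
elim: k v => [|k IHk] v.
  apply/rowP => -[[|[|//]] lt2]; rewrite mxE /=; congr (v _ _); exact: val_inj.
have [x [y ->]] := pfister_rowE v; apply: (congr2 (@row_mx F 1 (pN k) (pN k))).
  rewrite -[RHS]IHk; apply: eq_plane_row => J.
  by rewrite /= (negPf (ord0_up J)) row_mxKl upK.
rewrite -[RHS]IHk; apply: eq_plane_row => J.
by rewrite /= setU11 row_mxKr up1K.
Qed.

Lemma plane_row_linear k (c : F) (x y : {set 'I_k} -> plane) :
  plane_row (fun J => c *: x J + y J) = c *: plane_row x + plane_row y.
Proof.
elim: k x y => [|k IHk] x y.
  by apply/rowP => j; rewrite !mxE; case: ifP.
rewrite /= !IHk; set p1 := plane_row _; set q1 := plane_row _; set p2 := plane_row _;
  set q2 := plane_row _.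
have e : c *: row_mx p1 p2 + row_mx q1 q2 = row_mx (c *: p1 + q1) (c *: p2 + q2).
  by rewrite scale_row_mx add_row_mx.
exact: esym e.
Qed.

Lemma qfm_plane_row k (b : 'I_k -> F) a x :
  qfm (pfister_mx b a) (plane_row x) =
  \sum_(I : {set 'I_k}) (\prod_(i in I) b i) * binary_map 1 a (x I).
Proof.
elim: k b x => [|k IHk] b x.
  rewrite (big_pred1 set0) => [|I]; last by rewrite [RHS](_ : _ = true) //; apply/eqP/setP => -[].
  by rewrite big_set0 qfm_base !mxE /= /binary_map; ring.
rewrite [plane_row _]/= qfm_pfisterS !IHk sum_setS; congr (_ + _).
  by apply: eq_bigr => J _; rewrite big_imset //= => i j _ _; apply: lift_inj.
rewrite mulr_sumr; apply: eq_bigr => J _; rewrite big_setU1 ?ord0_up //= mulrA.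
by rewrite big_imset //= => i j _ _; apply: lift_inj.
Qed.

Lemma pfister_form_mxform k (b : 'I_k -> F) a :
  isometric (pfister_form b a) (mxform (pfister_mx b a)).
Proof.
pose f (x : {ffun {set 'I_k} -> plane}) := plane_row x.
have fl : linear f.
  move=> c x y; rewrite /f -plane_row_linear; apply: eq_plane_row => J.
  by rewrite !ffunE.
exists (HB.pack f (GRing.isLinear.Build _ _ _ _ f fl) : {linear _ -> _}); split.
  exists (fun v => [ffun I => row_plane v I]) => [x|v] /=.
    by apply/ffunP => I; rewrite ffunE plane_rowK.
  by rewrite /f -[RHS]row_planeK; apply: eq_plane_row => I; rewrite ffunE.
by move=> x; rewrite /= qfm_plane_row.
Qed.

End PfisterForm.

Section Hyperbolic.

Variables (E : fieldType) (N r : nat) (Q : 'M[E]_N) (Z : 'M[E]_(r, N)).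
Hypotheses (ch2 : 2%N \in [pchar E]) (Q_nondeg : forall v, (forall w, bfm Q v w = 0) -> v = 0).
Hypotheses (fZ : row_free Z) (dimZ : (r + r)%N = N) (qZ : forall x, qfm Q (x *m Z) = 0).

(** Nondegeneracy gives a family [S0] dual to [Z]. Subtracting [A^T *m Z], where [A] is the matrix
    of [Q] on [S0], cancels the values of [Q] without changing the pairings with [Z]. *)
Lemma dual_totally_isotropic : exists S : 'M[E]_(r, N),
  (forall x, qfm Q (x *m S) = 0) /\ forall x y, bfm Q (x *m Z) (y *m S) = (x *m y^T) 0 0.
Proof.
have bZ x y : bfm Q (x *m Z) (y *m Z) = 0 by rewrite bfm_qfm -mulmxDl !qZ !subr0.
have fM : row_free (Z *m (Q + Q^T)).
  apply: inj_row_free => v vM; apply: (row_free_inj fZ); rewrite mul0mx.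
  by apply: Q_nondeg => w; rewrite /bfm -(mulmxA v) vM mul0mx mxE.
pose S0 := (pinvmx (Z *m (Q + Q^T)))^T.
have bS0 x y : bfm Q (x *m Z) (y *m S0) = (x *m y^T) 0 0.
  have e : x *m Z *m (Q + Q^T) *m (y *m S0)^T = x *m (Z *m (Q + Q^T) *m S0^T) *m y^T.
    by rewrite trmx_mul !mulmxA.
  by rewrite /bfm e trmxK mulmxVp // mulmx1.
pose A := S0 *m Q *m S0^T.
exists (S0 - A^T *m Z); split=> [x|x y].
  rewrite mulmxBr mulmxA qfmD qfmN qZ addr0 bfmNr bfmC bS0.
  have -> : (x *m A^T *m x^T) 0 0 = qfm Q (x *m S0).
    rewrite -qfm_mul -/A; move: A => B.
    by rewrite -mx11_tr !trmx_mul !trmxK mulmxA.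
  by rewrite subrr.
by rewrite mulmxBr mulmxA bfmDr bfmNr bZ subr0 bS0.
Qed.

Lemma hyperbolic_mxform : hyperbolic (mxform Q).
Proof.
have [S [qS bZS]] := dual_totally_isotropic.
exists r; apply: isometric_sym.
pose v1 (v : {ffun 'I_r -> (E^o * E^o)%type}) : 'rV[E]_r := \row_i (v i).1.
pose v2 (v : {ffun 'I_r -> (E^o * E^o)%type}) : 'rV[E]_r := \row_i (v i).2.
pose f v := v1 v *m Z + v2 v *m S.
have fl : linear f.
  move=> c u v; rewrite /f.
  have -> : v1 (c *: u + v) = c *: v1 u + v1 v by apply/rowP => i; rewrite !mxE !ffunE.
  have -> : v2 (c *: u + v) = c *: v2 u + v2 v by apply/rowP => i; rewrite !mxE !ffunE.
  by rewrite !mulmxDl -!scalemxAl scalerDr addrACA.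
have qf v : qfm Q (f v) = \sum_i (v i).1 * (v i).2.
  rewrite /f qfmD qZ qS bZS !add0r mxE; apply: eq_bigr => i _.
  by rewrite !mxE.
have bZ x y : bfm Q (x *m Z) (y *m Z) = 0 by rewrite bfm_qfm -mulmxDl !qZ !subr0.
have bS x y : bfm Q (x *m S) (y *m S) = 0 by rewrite bfm_qfm -mulmxDl !qS !subr0.
(* Coordinates along [Z] are read by pairing with [S], and conversely. *)
pose g (w : 'rV[E]_N) : {ffun 'I_r -> (E^o * E^o)%type} :=
  [ffun i => (bfm Q w (row i S), bfm Q w (row i Z))].
have fK : cancel f g.
  move=> v; apply/ffunP => i; rewrite ffunE /f !rowE !bfmDl bS addr0 bZ add0r !bZS bfmC bZS.
  by rewrite trmx_delta -rowE -colE !mxE; case: (v i).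
have gK w : f (g w) = w.
  pose u (x : 'rV[E]_(r + r)) : {ffun 'I_r -> (E^o * E^o)%type} :=
    [ffun i => (lsubmx x 0 i, rsubmx x 0 i)].
  have fu x : f (u x) = x *m col_mx Z S.
    rewrite -[in RHS](hsubmxK x) mul_row_col /f.
    have -> : v1 (u x) = lsubmx x by apply/rowP => i; rewrite mxE ffunE.
    by have -> : v2 (u x) = rsubmx x by apply/rowP => i; rewrite mxE ffunE.
  have free : row_free (col_mx Z S).
    apply: inj_row_free => x x0; rewrite -[x]hsubmxK.
    have u0 i : u x i = (0, 0) by rewrite -(fK (u x)) fu x0 ffunE !bfm0l.
    have -> : lsubmx x = 0 by apply/rowP => i; have := u0 i; rewrite ffunE mxE => -[-> _];
      rewrite mxE.
    have -> : rsubmx x = 0 by apply/rowP => i; have := u0 i; rewrite ffunE => -[_ e];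
      rewrite e mxE.
    by rewrite row_mx0.
  have full : row_full (col_mx Z S) by rewrite /row_full (eqP free) dimZ.
  have /submxP[x def_w] : (w <= col_mx Z S)%MS by apply: submx_full.
  by rewrite def_w -fu fK.
exists (HB.pack f (GRing.isLinear.Build _ _ _ _ f fl) : {linear _ -> _}); split;
  first by exists g.
move=> v; rewrite /= qf /orth_sum_map; apply: eq_bigr => i _.
by rewrite /= /binary_map !mul0r addr0 add0r.
Qed.

End Hyperbolic.

(** The size [N.+1] excludes the zero space, a sum of no planes that is vacuously anisotropic. *)
Lemma hyperbolic_not_aniso (E : fieldType) N (Q : 'M[E]_N.+1) :
  hyperbolic (mxform Q) -> ~ aniso_mx Q.
Proof.
move=> [[|n] /isometric_sym[f [[g fK gK] qf]]] aQ.
  have gl0 v : g v = 0 by apply/ffunP => -[].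
  have /rowP/(_ ord0) : delta_mx 0 ord0 = 0 :> 'rV[E]_N.+1 by rewrite -[LHS]gK gl0 linear0.
  by rewrite !mxE => /eqP; rewrite oner_eq0.
pose v : {ffun 'I_n.+1 -> (E^o * E^o)%type} := [ffun => (1, 0)].
have /(can_inj fK) : f v = f 0.
  rewrite linear0; apply: aQ; rewrite -[LHS]/(mxform Q (f v)) qf /= /orth_sum_map big1 // => i _.
  by rewrite ffunE /= /binary_map /=; ring.
by move/ffunP/(_ ord0); rewrite !ffunE => -[/eqP]; rewrite oner_eq0.
Qed.

Lemma hyperbolic_pfister (E : fieldType) k (b : 'I_k -> E) a :
  2%N \in [pchar E] -> (forall i, b i != 0) ->
  hyperbolic (mxform (pfister_mx b a)) <-> ~ aniso_mx (pfister_mx b a).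
Proof.
move=> ch2 b0; split; first exact: hyperbolic_not_aniso.
move=> /(pfister_isotropic ch2 b0)[n [Z [qZ rZ]]].
apply: (@hyperbolic_mxform _ _ _ _ (row_base Z)) => //.
- by move=> v; apply: pfister_nondeg.
- exact: row_base_free.
- by rewrite addnn.
- move=> x; have /submxP[y ->] : (x *m row_base Z <= Z)%MS.
    by rewrite (submx_trans (submxMl _ _)) ?eq_row_base.
  exact: qZ.
Qed.

(** * Separable and inseparable quadratic extensions in characteristic 2 *)

Section QuadraticFieldExt.

Variables (E : fieldType) (K : fieldExtType E).
Hypotheses (ch2 : 2%N \in [pchar E]) (dimK : \dim {:K} = 2%N).
Local Notation "x %:K" := (in_alg K x) (at level 2, format "x %:K").

Lemma quadratic_ext_indep (t : K) : t \notin 1%VS ->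
  forall r s : E, r%:K + s%:K * t = 0 -> r = 0 /\ s = 0.
Proof.
move=> nt r s e; have s0 : s = 0.
  apply: contraNeq nt => s0; apply/vlineP; exists (- r / s).
  have sK : s%:K != 0 by rewrite fmorph_eq0.
  rewrite -[_ *: 1]/((- r / s)%:K); apply: (mulfI sK);
    rewrite -rmorphM [s * _]mulrC divfK // rmorphN.
  by apply/eqP; rewrite -addr_eq0 addrC e.
by move/eqP: e; rewrite s0 rmorph0 mul0r addr0 fmorph_eq0 => /eqP.
Qed.

Lemma quadratic_ext_span (t : K) : t \notin 1%VS ->
  forall x, exists r s : E, x = r%:K + s%:K * t.
Proof.
move=> nt x; have /memv_addP[u /vlineP[r ->] [v /vlineP[s ->] ->]] : x \in (1 + <[t]>)%VS.
  have sub1 : (1 <= 1 + <[t]>)%VS by apply: addvSl.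
  have [le1 eq1] := dimv_leqif_sup sub1.
  have lt1 : (1 < \dim (1 + <[t]>))%N.
    rewrite -[X in (X < _)%N](dimv1 K) ltn_neqAle le1 andbT eq1; apply: contra nt => /subvP;
      apply.
    by rewrite memvE addvSr.
  have [le2 eq2] := dimv_leqif_sup (subvf (1 + <[t]>)).
  have /subvP : ({:K} <= 1 + <[t]>)%VS by rewrite -eq2 eqn_leq le2 dimK lt1.
  by apply; apply: memvf.
by exists r, s; rewrite /= mulr_algl.
Qed.

(** In characteristic 2, [t] is separable exactly when it lies in E(t^2): here [t = t ^+ 2 - d] if
    [s] is true, while [t ^+ 2] is in [E] otherwise. *)
Lemma quadratic_ext_separable (t : K) (s : bool) (d : E) : t \notin 1%VS ->
  t ^+ 2 = s%:R%:K * t + d%:K -> separable 1 {:K} = s.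
Proof.
move=> nt t2; have ch2K : 2%N \in [pchar K] by rewrite (fmorph_pchar (in_alg K)).
have d1 : d%:K \in 1%VS by apply/vlineP; exists d.
have -> : separable 1 {:K} = separable_element 1 t.
  apply/separableP/idP => [|/adjoin_separableP tP y _]; first by apply; apply: memvf.
  apply: tP; have [r [u ->]] := quadratic_ext_span nt y.
  have in1 z : z%:K \in <<1; t>>%VS.
    by apply: (subvP (subv_adjoin _ _)); apply/vlineP; exists z.
  by rewrite rpredD ?rpredM ?memv_adjoin.
rewrite (pcharf_p_separable _ _ 0 ch2K) expn1 t2; case: s t2 => t2.
  set y := _ + _; have -> : t = y - d%:K by rewrite /y rmorph1 mul1r addrK.
  rewrite rpredB ?memv_adjoin //; exact: (subvP (subv_adjoin _ _)).
rewrite rmorph0 mul0r add0r; have /Fadjoin_idP -> := d1.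
exact: negPf.
Qed.

Lemma quadratic_ext_no_root (t : K) c d : t \notin 1%VS ->
  t ^+ 2 = c%:K * t + d%:K -> no_root c d.
Proof.
move=> nt t2 r; apply/eqP => rd; case/negP: nt.
have : (t - r%:K) * (t - (c - r)%:K) = 0.
  have -> : (t - r%:K) * (t - (c - r)%:K) =
      t ^+ 2 - (c%:K * t + d%:K) + (c * r + d - r ^+ 2)%:K.
    by rewrite !(rmorphB, rmorphD, rmorphM, rmorphXn) /=; ring.
  by rewrite t2 -rd !subrr rmorph0 addr0.
by move=> /eqP; rewrite mulf_eq0 !subr_eq0 => /orP[] /eqP ->; apply/vlineP; eexists.
Qed.

(** A generator [u] with [u ^+ 2 = c + b u] is kept if [b = 0], and replaced by [u / b] otherwise,
    as in Artin-Schreier theory. *)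
Lemma quadratic_ext_generator :
  exists (t : K) (d : E), t \notin 1%VS /\ t ^+ 2 = (separable 1 {:K})%:R%:K * t + d%:K.
Proof.
have /subvPn[u _ nu] : ~~ ({:K} <= 1)%VS.
  by apply/negP => /dimvS; rewrite dimK dimv1.
have ch2K : 2%N \in [pchar K] by rewrite (fmorph_pchar (in_alg K)).
have [c [b u2]] := quadratic_ext_span nu (u ^+ 2).
have [s [t [d [nt t2]]]] : exists (s : bool) (t : K) d, t \notin 1%VS /\ t ^+ 2 = s%:R%:K * t +
  d%:K.
  have [b0|b0] := eqVneq b 0.
    by exists false, u, c; split=> //; rewrite u2 b0 !rmorph0 !mul0r addrC.
  have bK : b%:K != 0 by rewrite fmorph_eq0.
  exists true, (u / b%:K), (c / b ^+ 2); split.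
    apply: contra nu => /vlineP[z uz]; apply/vlineP; exists (b * z).
    have <- : (b * z)%:K = u by rewrite rmorphM mulrC -[RHS](divfK bK) uz.
    by [].
  by rewrite rmorph1 rmorphM fmorphV rmorphXn expr_div_n u2; field.
by exists t, d; rewrite (quadratic_ext_separable nt t2).
Qed.

End QuadraticFieldExt.

Lemma quadratic_ext_exists (E : fieldType) (s : bool) (d : E) :
  2%N \in [pchar E] -> no_root s%:R d ->
  exists (K : fieldExtType E) (t : K), [/\ \dim {:K} = 2%N, t \notin 1%VS &
    t ^+ 2 = in_alg K s%:R * t + in_alg K d].
Proof.
move=> ch2 nr; pose p : {poly E} := 'X^2 + (s%:R *: 'X + d%:P).
have lt2 : (size (s%:R *: 'X + d%:P : {poly E})%R < 3)%N.
  rewrite ltnS (leq_trans (size_polyD _ _)) // geq_max.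
  by rewrite (leq_trans (size_scale_leq _ _)) ?size_polyX // (leq_trans (size_polyC_leq1 _)).
have sp : size p = 3%N by rewrite /p size_polyDl size_polyXn.
have irr : irreducible_poly p.
  apply: cubic_irreducible => [|x]; first by rewrite sp.
  rewrite rootE !hornerE; apply: contra (nr x) => /eqP rx.
  by rewrite -subr_eq0 (oppr_pchar2 ch2); apply/eqP/(etrans (addrA _ _ _) rx).
have [K dK [t rt defK]] := irredp_FAdjoin irr.
have ch2K : 2%N \in [pchar K] by rewrite (fmorph_pchar (in_alg K)).
have t2 : t ^+ 2 = in_alg K s%:R * t + in_alg K d.
  move: rt; rewrite rootE /p !rmorphD /= map_polyXn map_polyZ map_polyX map_polyC !hornerE =>
    /eqP rt.
  by apply/eqP; rewrite -subr_eq0 (oppr_pchar2 ch2K); apply/eqP/(etrans (addrA _ _ _) rt).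
exists K, t; split=> //; first by rewrite dK sp.
apply/vlineP => -[r tr]; case/eqP: (nr r); apply: (fmorph_inj (in_alg K)).
by rewrite rmorphXn rmorphD rmorphM /= -tr.
Qed.

(** * Splitting of Pfister forms by quadratic extensions, and linkage *)

Lemma isometric_pfister_ext (F E : fieldType) (iota : {rmorphism F -> E}) (V : vectType F)
    (q : qform V) k (b : 'I_k -> F) a :
  isometric q (mxform (pfister_mx b a)) ->
  isometric (scalar_ext iota q) (mxform (pfister_mx (iota \o b) (iota a))).
Proof. by move=> qP; rewrite -pfister_mx_map; apply: scalar_ext_mxform. Qed.

Lemma hyperbolic_quadratic_ext (E : fieldType) (K : fieldExtType E) (V : vectType E)
    (q : qform V) k (b : 'I_k -> E) a (t : K) (s : bool) d :
  2%N \in [pchar E] -> \dim {:K} = 2%N -> t \notin 1%VS ->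
  t ^+ 2 = in_alg K s%:R * t + in_alg K d -> (forall i, b i != 0) ->
  isometric q (mxform (pfister_mx b a)) ->
  hyperbolic (scalar_ext (in_alg K) q) <-> ~ aniso_quad (pfister_mx b a) s%:R d.
Proof.
move=> ch2 dK nt t2 b0 qP.
have ch2K : 2%N \in [pchar K] by rewrite (fmorph_pchar (in_alg K)).
have iso := isometric_pfister_ext (in_alg K) qP.
have ib0 : forall i, (in_alg K \o b) i != 0 by move=> i; rewrite fmorph_eq0.
have nr := quadratic_ext_no_root nt t2.
have spanK := quadratic_ext_span dK nt; have indep := quadratic_ext_indep nt.
have anisoE : aniso_mx (pfister_mx (in_alg K \o b) (in_alg K a)) <-> aniso_quad (pfister_mx b a)
  s%:R d.
  rewrite -pfister_mx_map; split=> [aK|aE].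
    exact: (aniso_quad_restrict t2 nr aK).
  exact: (aniso_quad_extend t2 spanK aE indep).
split=> [/(isometric_hyperbolic iso)/(hyperbolic_pfister _ ch2K ib0)|] n.
  by move/anisoE.
apply: (isometric_hyperbolic (isometric_sym iso)).
by apply/(hyperbolic_pfister _ ch2K ib0) => /anisoE.
Qed.

(* Total linkage is obtained in the strong form that all the quadratic extensions of
   kind [s] split both forms over [E]. *)
Lemma link_one_kind (F : fieldType) (ch2 : 2%N \in [pchar F]) (k : nat) (s : bool)
    (V V' : vectType F) (p : qform V) (p' : qform V')
    (b b' : 'I_k.+1 -> F) (a a' : F) (K : fieldExtType F) :
  (forall i, b i != 0) -> (forall i, b' i != 0) ->
  isometric p (mxform (pfister_mx b a)) -> isometric p' (mxform (pfister_mx b' a')) ->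
  anisotropic p ->
  \dim {:K} = 2%N -> separable 1 {:K} = ~~ s ->
  hyperbolic (scalar_ext (in_alg K) p) -> ~ hyperbolic (scalar_ext (in_alg K) p') ->
  exists (E : fieldType) (iota : {rmorphism F -> E}),
    [/\ anisotropic (scalar_ext iota p), anisotropic (scalar_ext iota p'),
        forall L : fieldExtType E, \dim {:L} = 2%N -> separable 1 {:L} = s ->
          hyperbolic (scalar_ext (in_alg L) (scalar_ext iota p)) /\
          hyperbolic (scalar_ext (in_alg L) (scalar_ext iota p')) &
        exists L : fieldExtType E, [/\ \dim {:L} = 2%N, separable 1 {:L} = ~~ s,
          hyperbolic (scalar_ext (in_alg L) (scalar_ext iota p)) &
          ~ hyperbolic (scalar_ext (in_alg L) (scalar_ext iota p'))]].
Proof.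
move=> b0 b'0 pP p'P ap dK sepK hp nhp'.
have [t [g2 [nt t2]]] := quadratic_ext_generator ch2 dK; rewrite sepK in t2.
have nr := quadratic_ext_no_root nt t2.
have aP : aniso_mx (pfister_mx b a).
  by apply/anisotropic_mxform; apply: isometric_anisotropic pP ap.
have aP' : aniso_quad (pfister_mx b' a') (~~ s)%:R g2.
  by apply: contra_notP nhp' => n; apply/(hyperbolic_quadratic_ext ch2 dK nt t2 b'0 p'P).
have nP : ~ aniso_quad (pfister_mx b a) (~~ s)%:R g2.
  exact/(hyperbolic_quadratic_ext ch2 dK nt t2 b0 pP).
have k0 : keeps s g2 (pfister_mx b a) (pfister_mx b' a') (idfun : {rmorphism F -> F}).
  by split; rewrite ?map_mx_id.
have [E [i [[aPE nrE aPE'] spl]]] := split_closure ch2 b0 b'0 k0.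
have ch2E : 2%N \in [pchar E] by rewrite (fmorph_pchar i).
have ib0 : forall r, (i \o b) r != 0 by move=> r; rewrite fmorph_eq0.
have ib'0 : forall r, (i \o b') r != 0 by move=> r; rewrite fmorph_eq0.
have pE := isometric_pfister_ext i pP; have p'E := isometric_pfister_ext i p'P.
have mapP c e : map_mx i (pfister_mx c e) = pfister_mx (i \o c) (i e) := pfister_mx_map i c e.
exists E, i; split.
- apply: isometric_anisotropic (isometric_sym pE) _; apply/anisotropic_mxform.
  by rewrite -mapP.
- apply: isometric_anisotropic (isometric_sym p'E) _; apply/anisotropic_mxform.
  by rewrite -mapP; apply: aniso_quad_aniso aPE'.
- move=> L dL sepL.
  have [u [d [nu u2]]] := quadratic_ext_generator ch2E dL; rewrite sepL in u2.
  have splitsE c e : (forall r, c r != 0) -> splits s (pfister_mx c e) i d ->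
      ~ aniso_quad (pfister_mx (i \o c) (i e)) s%:R d.
    move=> c0 [[r rd]|[v [qv bv]]] aE.
      by case/eqP: (quadratic_ext_no_root nu u2 r).
    (* The pair [v], [e0] satisfies both equations of [aniso_quad], whose left sides are twice [d]
       and twice [s]. *)
    rewrite mapP in qv bv; have [] := aE v pfister_e0.
    - by rewrite qv qfm_e0 // mulr1 (char2_dbl ch2E).
    - by rewrite bv qfm_e0 // mulr1 (char2_dbl ch2E).
    by move=> _ /rowP/(_ ord0); rewrite !mxE => /eqP; rewrite oner_eq0.
  have [s1 s2] := spl d; split.
    by apply/(hyperbolic_quadratic_ext ch2E dL nu u2 ib0 pE); apply: splitsE.
  by apply/(hyperbolic_quadratic_ext ch2E dL nu u2 ib'0 p'E); apply: splitsE.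
(* [L] is the compositum of [K] and [E]: the equation of [K] still has no root in [E]. *)
have [L [u [dL nu u2]]] := quadratic_ext_exists ch2E nrE.
exists L; split=> //.
- exact: (quadratic_ext_separable ch2E dL nu u2).
- apply/(hyperbolic_quadratic_ext ch2E dL nu u2 ib0 pE); rewrite -mapP => aE;
  apply: nP => v w qv bv.
  have [] := aE (map_mx i v) (map_mx i w).
  + by rewrite !qfm_map -rmorphM -rmorphD qv rmorph0.
  + by rewrite qfm_map (bfm_map i) -(rmorph_nat i) -rmorphM -rmorphD bv rmorph0.
  by move=> /eqP + /eqP; rewrite !map_mx_eq0 => /eqP -> /eqP ->.
by apply/(hyperbolic_quadratic_ext ch2E dL nu u2 ib'0 p'E); rewrite -mapP.
Qed.

Theorem corollary5p5 (F : fieldType) (charF2 : 2%N \in [pchar F])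
    (n : nat) (n_gt1 : (1 < n)%N)
    (V V' : vectType F) (p : qform V) (p' : qform V')
    (pfister_p : is_pfister n p) (pfister_p' : is_pfister n p')
    (aniso_p : anisotropic p) (aniso_p' : anisotropic p') :
  (~ tot_sep_linked p p' ->
   exists (E : fieldType) (iota : {rmorphism F -> E}),
     let pE := scalar_ext iota p in
     let pE' := scalar_ext iota p' in
     anisotropic pE /\ anisotropic pE' /\
     tot_insep_linked pE pE' /\ ~ tot_sep_linked pE pE')
  /\
  (~ tot_insep_linked p p' ->
   exists (E : fieldType) (iota : {rmorphism F -> E}),
     let pE := scalar_ext iota p in
     let pE' := scalar_ext iota p' in
     anisotropic pE /\ anisotropic pE' /\
     tot_sep_linked pE pE' /\ ~ tot_insep_linked pE pE').
Proof.
case: n n_gt1 pfister_p pfister_p' => [//|[//|k]] _ [_ [b [a [b0 pP]]]] [_ [b' [a' [b'0 p'P]]]].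
have {}pP := isometric_trans pP (pfister_form_mxform b a).
have {}p'P := isometric_trans p'P (pfister_form_mxform b' a').
split=> [/not_andP[]|/not_andP[]] /existsNP[K /not_implyP[dK /not_implyP[sK /not_implyP[hp
  hp']]]].
(* Part (a): the given [K] is separable, so the inseparable kind [s = false] is made to split. *)
- have [E [i [aE aE' allL [L [dL sL hL hL']]]]] :=
    @link_one_kind _ charF2 k false _ _ _ _ _ _ _ _ K b0 b'0 pP p'P aniso_p dK sK hp hp'.
  exists E, i; do 2!split=> //; split.
    by split=> M dM /negPf sM _; have [] := allL M dM sM.
  by case=> /(_ L dL sL hL).
(* Linkage fails in the other direction: [p] and [p'] exchange roles. *)
- have [E [i [aE aE' allL [L [dL sL hL hL']]]]] :=
    @link_one_kind _ charF2 k false _ _ _ _ _ _ _ _ K b'0 b0 p'P pP aniso_p' dK sK hp hp'.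
  exists E, i; do 2!split=> //; split.
    by split=> M dM /negPf sM _; have [] := allL M dM sM.
  by case=> _ /(_ L dL sL hL).
(* Part (b): the given [K] is inseparable, so the separable kind [s = true] is made to split. *)
- have [E [i [aE aE' allL [L [dL sL hL hL']]]]] :=
    @link_one_kind _ charF2 k true _ _ _ _ _ _ _ _ K b0 b'0 pP p'P aniso_p dK (negPf sK) hp hp'.
  exists E, i; do 2!split=> //; split.
    by split=> M dM sM _; have [] := allL M dM sM.
  by case=> /(_ L dL (negbT sL) hL).
- have [E [i [aE aE' allL [L [dL sL hL hL']]]]] :=
    @link_one_kind _ charF2 k true _ _ _ _ _ _ _ _ K b'0 b0 p'P pP aniso_p' dK (negPf sK) hp hp'.
  exists E, i; do 2!split=> //; split.
    by split=> M dM sM _; have [] := allL M dM sM.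
  by case=> _ /(_ L dL (negbT sL) hL).
Qed.
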